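(* Every graph property $\Pi=(\Pi_n)_{n\in\mathbb{N}}$ that is constant-query testable with one-sided error in the random neighbor/edge model is also constant-space testable with one-sided error in random order graph streams.
   Context: Graphs are simple, undirected, on $V=[n]$, with $|E|=\Omega(|V|)$ assumed. $G$ is $\varepsilon$-far from $\Pi_n$ if every graph in $\Pi_n$ differs from $G$ on at least $\varepsilon|E(G)|$ edges. Random neighbor/edge model: the algorithm gets $n$ and oracle access to $G$; a random edge query returns an edge chosen independently and uniformly at random from $E$; a random neighbor query for $v$ returns an independent uniformly random neighbor of $v$; uniform vertices of $[n]$ can be sampled; queries may be adaptive. Constant-query testable with one-sided error: for every $\varepsilon>0$ and $n$ there is an algorithm making at most $q(\varepsilon)$ queries (independent of $n$) that accepts every graph in $\Pi_n$ with probability $1$ and rejects every $\varepsilon$-far $n$-vertex graph with probability at least $2/3$. Random order graph stream: the edges of $G$ arrive in the order of a uniformly random permutation of $E$, read in a single pass. Constant-space testable with one-sided error: for every $\varepsilon>0$ and $n$ there is such a single-pass algorithm using at most $q(\varepsilon)$ words of space (independent of $n$; a word stores one vertex or edge ID) that accepts graphs in $\Pi_n$ with probability $1$ and rejects $\varepsilon$-far graphs with probability at least $2/3$. *)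

(* Defs.v *)
From HB Require Import structures.
From mathcomp Require Import all_boot all_order all_algebra.
From mathcomp Require Import fingroup perm.
From mathcomp Require Import reals.
Set Implicit Arguments. Unset Strict Implicit. Unset Printing Implicit Defensive.
Import Order.TTheory GRing.Theory Num.Theory.
Local Open Scope ring_scope.

(* Graphs on V = [n] = 'I_n.  An undirected edge {u,v} is stored as the    *)
(* ordered pair (u,v) with u < v; a graph is its (finite) edge set.        *)
Definition edge n := ('I_n * 'I_n)%type.

Definition simple_graph n (E : {set edge n}) : Prop :=
  forall e, e \in E -> (nat_of_ord e.1 < nat_of_ord e.2)%N.

Definition mkedge n (u v : 'I_n) : edge n :=
  if (nat_of_ord u < nat_of_ord v)%N then (u, v) else (v, u).

Definition relabel n (s : {perm 'I_n}) (E : {set edge n}) : {set edge n} :=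
  [set mkedge (s e.1) (s e.2) | e in E].

Definition graph_property := forall n, {set edge n} -> Prop.

Definition iso_invariant (Pi : graph_property) : Prop :=
  forall n (s : {perm 'I_n}) (E : {set edge n}),
    simple_graph E -> Pi n E -> Pi n (relabel s E).

Definition edge_dist n (E H : {set edge n}) : nat := #|(E :\: H) :|: (H :\: E)|.

Definition far (R : realType) (eps : R) (Pi : graph_property) n
    (E : {set edge n}) : Prop :=
  forall H : {set edge n}, simple_graph H -> Pi n H ->
    eps * (#|E|)%:R <= (edge_dist E H)%:R.

Definition neighbors n (E : {set edge n}) (v : 'I_n) : {set 'I_n} :=
  [set u | ((u, v) \in E) || ((v, u) \in E)].

(* Random neighbor/edge model: randomized adaptive query algorithms are    *)
(* decision trees.  Internal randomness: a uniform choice in 'I_k.+1.      *)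
(* Oracle queries: uniform vertex of [n]; uniform random edge (None if E   *)
(* is empty); uniform random neighbor of v (None if v is isolated).        *)
Inductive qtree (n : nat) : Type :=
| QLeaf : bool -> qtree n
| QRand : forall k : nat, ('I_k.+1 -> qtree n) -> qtree n
| QVert : ('I_n -> qtree n) -> qtree n
| QEdge : (option (edge n) -> qtree n) -> qtree n
| QNbr  : 'I_n -> (option 'I_n -> qtree n) -> qtree n.

Fixpoint qcount n (t : qtree n) : nat :=
  match t with
  | QLeaf _ => 0
  | QRand k f => \max_(i : 'I_k.+1) qcount (f i)
  | QVert f => (\max_(v : 'I_n) qcount (f v)).+1
  | QEdge f => (\max_(o : option (edge n)) qcount (f o)).+1
  | QNbr _ f => (\max_(o : option 'I_n) qcount (f o)).+1
  end.

Fixpoint qaccept (R : realType) n (E : {set edge n}) (t : qtree n) : R :=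
  match t with
  | QLeaf b => if b then 1 else 0
  | QRand k f => (\sum_(i : 'I_k.+1) qaccept R E (f i)) / (k.+1)%:R
  | QVert f => (\sum_(v : 'I_n) qaccept R E (f v)) / n%:R
  | QEdge f =>
      if E == set0 then qaccept R E (f None)
      else (\sum_(e in E) qaccept R E (f (Some e))) / (#|E|)%:R
  | QNbr v f =>
      if neighbors E v == set0 then qaccept R E (f None)
      else (\sum_(u in neighbors E v) qaccept R E (f (Some u)))
             / (#|neighbors E v|)%:R
  end.
Arguments qaccept {R n}.

(* Constant-query testable with one-sided error, for graphs with
   |E| >= c |V| (the standing assumption |E| = Omega(|V|)). *)
Definition query_testable (R : realType) (c : R) (Pi : graph_property) : Prop :=
  forall eps : R, 0 < eps -> exists q : nat, forall n : nat,
    exists t : qtree n, (qcount t <= q)%N /\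
      forall E : {set edge n}, simple_graph E -> c * n%:R <= (#|E|)%:R ->
        (Pi n E -> @qaccept R n E t = 1) /\
        (far eps Pi E -> @qaccept R n E t <= 1 / 3).

Inductive rtree (A : Type) : Type :=
| RRet : A -> rtree A
| RRand : forall k : nat, ('I_k.+1 -> rtree A) -> rtree A.

Fixpoint rexp (R : realType) A (t : rtree A) (g : A -> R) : R :=
  match t with
  | RRet a => g a
  | RRand k f => (\sum_(i : 'I_k.+1) rexp (f i) g) / (k.+1)%:R
  end.
Arguments rexp {R A}.

Definition word n := ('I_n + edge n)%type.

Definition memory n q := (q.-tuple (option (word n)))%type.

Record stream_alg (n q : nat) := StreamAlg {
  s_init : rtree (memory n q);
  s_step : memory n q -> edge n -> rtree (memory n q);
  s_out  : memory n q -> rtree bool }.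

Fixpoint run_accept (R : realType) n q (A : stream_alg n q)
    (m : memory n q) (s : seq (edge n)) : R :=
  match s with
  | [::] => rexp (s_out A m) (fun b : bool => if b then 1 else 0)
  | e :: s' => rexp (s_step A m e) (fun m' => run_accept R A m' s')
  end.
Arguments run_accept {R n q}.

Definition saccept (R : realType) n q (A : stream_alg n q)
    (E : {set edge n}) : R :=
  (\sum_(s <- permutations (enum E))
      rexp (s_init A) (fun m => run_accept A m s)) / ((#|E|)`!)%:R.
Arguments saccept {R n q}.

Definition stream_testable (R : realType) (c : R) (Pi : graph_property) : Prop :=
  forall eps : R, 0 < eps -> exists q : nat, forall n : nat,
    exists A : stream_alg n q,
      forall E : {set edge n}, simple_graph E -> c * n%:R <= (#|E|)%:R ->
        (Pi n E -> @saccept R n q A E = 1) /\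
        (far eps Pi E -> @saccept R n q A E <= 1 / 3).

(* Main.v *)
(** A one-sided tester that rejects has seen a certificate: edges present in the
graph and vertices isolated in it that together occur in no graph of the
property. So it suffices to find certificates in the stream.

Since the property is invariant under relabelling, a vertex that the tester
names without having seen it is as good as a uniform one. Hence, up to a factor
depending only on the number of queries, the tester is dominated by a canonical
exploration: draw k uniform vertices, then k times query a random edge, or a
random edge at a known vertex, chosen at random. Explored edges are distinct,
and a fixed edge is explored with probability O(1/n), because the law of each
known vertex is at most proportional to its degree.

The stream algorithm samples every step by a reservoir that starts when the
previous step stores its edge. If the edges of an exploration arrive in the
order of exploration, the algorithm finds it with at least the probability of
the exploration, because it chooses among fewer candidates. Let F(s) be the
probability, for a fixed order s, that the exploration yields a certificate
whose edges arrive in order. Its mean is bounded below, as k edges are in order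
with probability 1/k!. Its variance is O(1/n), as two independent explorations
rarely share an edge, and the relative orders of disjoint edge sets are
independent. By Chebyshev, F(s) is bounded below for most orders s, and a
constant number of parallel runs, independent given s, succeeds. For bounded n
the algorithm stores the whole graph. *)

Require Import Defs.
From HB Require Import structures.
From mathcomp Require Import all_boot all_order all_algebra.
From mathcomp Require Import fingroup perm.
From mathcomp Require Import boolp reals ring lra zify.
Set Implicit Arguments. Unset Strict Implicit. Unset Printing Implicit Defensive.
Import Order.TTheory GRing.Theory Num.Theory.
Local Open Scope ring_scope.

(** * Random trees and averages over sequences *)

Section RandomTrees.
Variable R : realType.

Fixpoint rbind A B (t : rtree A) (f : A -> rtree B) : rtree B :=
  match t with
  | RRet a => f a
  | RRand k h => RRand (fun i => rbind (h i) f)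
  end.

Lemma rexp_bind A B (t : rtree A) (f : A -> rtree B) (g : B -> R) :
  rexp (rbind t f) g = rexp t (fun a => rexp (f a) g).
Proof. by elim: t => [//|k h IH] /=; congr (_ / _); apply: eq_bigr. Qed.

Lemma eq_rexp A (t : rtree A) (g h : A -> R) : g =1 h -> rexp t g = rexp t h.
Proof.
by move=> gh; elim: t => [a|k f IH] /=; [exact: gh | congr (_ / _); apply: eq_bigr].
Qed.

Lemma rexp_const A (t : rtree A) (x : R) : rexp t (fun=> x) = x.
Proof.
elim: t => [//|k f IH] /=; rewrite (eq_bigr (fun=> x)) => [|i _]; last exact: IH.
by rewrite sumr_const card_ord -[x *+ _]mulr_natr mulfK // pnatr_eq0.
Qed.

Lemma rexp_lin A (t : rtree A) (g h : A -> R) (a : R) :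
  rexp t (fun x => a * g x + h x) = a * rexp t g + rexp t h.
Proof.
elim: t => [//|k f IH] /=.
rewrite (eq_bigr _ (fun i _ => IH i)) big_split /= -mulr_sumr mulrDl; ring.
Qed.

Lemma rexp_mull A (t : rtree A) (g : A -> R) (a : R) :
  rexp t (fun x => a * g x) = a * rexp t g.
Proof.
rewrite -[RHS]addr0 -[X in _ + X](rexp_const t 0) -rexp_lin.
by apply: eq_rexp => x; rewrite addr0.
Qed.

Lemma rexp_mulr A (t : rtree A) (g : A -> R) (a : R) :
  rexp t (fun x => g x * a) = rexp t g * a.
Proof. by rewrite mulrC -rexp_mull; apply: eq_rexp => x; rewrite mulrC. Qed.

Lemma rexp_1B A (t : rtree A) (g : A -> R) :
  rexp t (fun x => 1 - g x) = 1 - rexp t g.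
Proof.
rewrite -[X in X - _](rexp_const t 1) addrC -mulN1r -rexp_lin.
by apply: eq_rexp => x; rewrite mulN1r addrC.
Qed.

Lemma le_rexp A (t : rtree A) (g h : A -> R) :
  (forall x, g x <= h x) -> rexp t g <= rexp t h.
Proof.
move=> gh; elim: t => [a|k f IH] /=; first exact: gh.
by rewrite ler_pM2r ?invr_gt0 ?ltr0n //; apply: ler_sum.
Qed.

Lemma rexp_ge0 A (t : rtree A) (g : A -> R) :
  (forall x, 0 <= g x) -> 0 <= rexp t g.
Proof. by move=> g0; rewrite -(rexp_const t 0); apply: le_rexp. Qed.

Definition runif (T : finType) (x0 : T) : rtree T :=
  RRand (fun i : 'I_(#|T|.-1).+1 => RRet (nth x0 (enum T) i)).

Lemma rexp_unif (T : finType) (x0 : T) (g : T -> R) :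
  rexp (runif x0) g = (\sum_x g x) / #|T|%:R.
Proof.
have T0 : (0 < #|T|)%N by apply/card_gt0P; exists x0.
rewrite /= (prednK T0); congr (_ / _).
by rewrite -[RHS]big_enum /= (big_nth x0) big_mkord -cardT.
Qed.

Fixpoint runif_tuple (T : finType) (x0 : T) (k : nat) : rtree (k.-tuple T) :=
  if k is k'.+1 then
    rbind (runif x0) (fun x =>
      rbind (runif_tuple x0 k') (fun t => RRet (cons_tuple x t)))
  else RRet [tuple].

(** Expectation over [k] independent uniform elements. Taking functions of plain sequences lets an
    induction absorb the first entry into [G]. *)
Fixpoint avg_seq (T : finType) (k : nat) (G : seq T -> R) : R :=
  if k is k'.+1 then
    (\sum_(x : T) avg_seq k' (fun s => G (x :: s))) / #|T|%:R
  else G [::].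

Lemma rexp_unif_tuple (T : finType) (x0 : T) k (G : seq T -> R) :
  rexp (runif_tuple x0 k) (fun t => G (tval t)) = avg_seq k G.
Proof.
elim: k G => [//|k IH] G; cbn [runif_tuple avg_seq].
rewrite rexp_bind rexp_unif; congr (_ / _); apply: eq_bigr => x _.
by rewrite rexp_bind -IH.
Qed.

Lemma eq_avg_seq (T : finType) k (G H : seq T -> R) :
  (forall s, size s = k -> G s = H s) -> avg_seq k G = avg_seq k H.
Proof.
elim: k G H => [|k IH] G H GH /=; first exact: GH.
by congr (_ / _); apply: eq_bigr => x _; apply: IH => s ss; apply: GH; rewrite /= ss.
Qed.

Lemma le_avg_seq (T : finType) k (G H : seq T -> R) :
  (forall s, size s = k -> G s <= H s) -> avg_seq k G <= avg_seq k H.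
Proof.
elim: k G H => [|k IH] G H GH /=; first exact: GH.
rewrite ler_wpM2r ?invr_ge0 //; apply: ler_sum => x _.
by apply: IH => s ss; apply: GH; rewrite /= ss.
Qed.

Lemma avg_seq_mull (T : finType) k (G : seq T -> R) a :
  avg_seq k (fun s => a * G s) = a * avg_seq k G.
Proof.
elim: k G => [//|k IH] G /=.
by rewrite (eq_bigr _ (fun x _ => IH _)) -mulr_sumr mulrA.
Qed.

Lemma avg_seq_mulr (T : finType) k (G : seq T -> R) a :
  avg_seq k (fun s => G s * a) = avg_seq k G * a.
Proof. by rewrite mulrC -avg_seq_mull; apply: eq_avg_seq => s _; rewrite mulrC. Qed.

Lemma avg_seq_sum (T : finType) I (r : seq I) (p : pred I) k (G : I -> seq T -> R) :
  avg_seq k (fun s => \sum_(i <- r | p i) G i s) = \sum_(i <- r | p i) avg_seq k (G i).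
Proof.
elim: k G => [//|k IH] G /=.
rewrite -mulr_suml; congr (_ / _); rewrite exchange_big /=.
by apply: eq_bigr => x _; rewrite IH.
Qed.

Lemma avg_seqD (T : finType) k (G H : seq T -> R) :
  avg_seq k (fun s => G s + H s) = avg_seq k G + avg_seq k H.
Proof.
elim: k G H => [//|k IH] G H /=.
by rewrite (eq_bigr _ (fun x _ => IH _ _)) big_split mulrDl.
Qed.

Lemma avg_seq_const (T : finType) k (a : R) :
  (0 < #|T|)%N -> avg_seq k (fun _ : seq T => a) = a.
Proof.
move=> T0; elim: k => [//|k IH] /=.
rewrite IH sumr_const -[a *+ _]mulr_natr mulfK // pnatr_eq0.
by rewrite -lt0n.
Qed.

Lemma avg_seq_ge0 (T : finType) k (G : seq T -> R) :
  (forall s, 0 <= G s) -> 0 <= avg_seq k G.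
Proof.
elim: k G => [|k IH] G G0 /=; first exact: G0.
by apply: divr_ge0 => //; apply: sumr_ge0 => x _; apply: IH.
Qed.

(** A position below [k] is uniform, and a position past the end is never [Some x]. *)
Lemma avg_seq_onth (T : finType) k i (x : T) :
  avg_seq k (fun s => (onth s i == Some x)%:R) <= #|T|%:R^-1.
Proof.
have T0 : (0 < #|T|)%N by apply/card_gt0P; exists x.
elim: k i => [|k IH] [|i] /=; rewrite ?invr_ge0 //.
  rewrite -[leRHS]mul1r ler_wpM2r ?invr_ge0 //.
  rewrite (bigD1 x) //= eqxx avg_seq_const // big1 ?addr0 // => y yx.
  rewrite -[RHS](avg_seq_const k 0 T0); apply: eq_avg_seq => s _.
  by case: eqP => // -[] /eqP; rewrite (negPf yx).
rewrite ler_pdivrMr ?ltr0n // mulVf ?pnatr_eq0 -?lt0n //.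
rewrite (le_trans (ler_sum _ (fun y _ => IH i))) //.
by rewrite sumr_const -[_ *+ _]mulr_natr mulVf // pnatr_eq0 -lt0n.
Qed.

End RandomTrees.

(** * Streaming algorithms with an arbitrary finite state *)

Section StateAlgorithms.
Variables (R : realType) (n : nat).

(** Mirrors [stream_alg] with any type of states, so that algorithms can be built from products;
    [encode_alg] returns to words by counting states. *)
Record state_alg (M : Type) := StateAlg {
  a_init : rtree M;
  a_step : M -> edge n -> rtree M;
  a_out : M -> rtree bool }.

Fixpoint arun M (A : state_alg M) (m : M) (s : seq (edge n)) : R :=
  match s with
  | [::] => rexp (a_out A m) (fun b : bool => if b then 1 else 0)
  | e :: s' => rexp (a_step A m e) (fun m' => arun A m' s')
  end.

Definition aaccept M (A : state_alg M) (s : seq (edge n)) : R :=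
  rexp (a_init A) (fun m => arun A m s).

Lemma arun_ge0 M (A : state_alg M) m s : 0 <= arun A m s.
Proof.
elim: s m => [|e s IH] m /=; apply: rexp_ge0 => // -[] //.
Qed.

Lemma aaccept_ge0 M (A : state_alg M) s : 0 <= aaccept A s.
Proof. by apply: rexp_ge0 => m; apply: arun_ge0. Qed.

(** Parallel runs with independent coins on the same stream. Accepting only if both accept keeps the
    error one-sided. *)
Definition prod_alg M1 M2 (A : state_alg M1) (B : state_alg M2) :
    state_alg (M1 * M2) :=
  {| a_init := rbind (a_init A) (fun m1 =>
       rbind (a_init B) (fun m2 => RRet (m1, m2)));
     a_step m e := rbind (a_step A m.1 e) (fun m1 =>
       rbind (a_step B m.2 e) (fun m2 => RRet (m1, m2)));
     a_out m := rbind (a_out A m.1) (fun b1 =>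
       rbind (a_out B m.2) (fun b2 => RRet (b1 && b2))) |}.

Lemma rexp_pair M1 M2 (t1 : rtree M1) (t2 : rtree M2) (g1 : M1 -> R) (g2 : M2 -> R)
    M (h : M1 -> M2 -> M) (g : M -> R) :
  (forall m1 m2, g (h m1 m2) = g1 m1 * g2 m2) ->
  rexp (rbind t1 (fun m1 => rbind t2 (fun m2 => RRet (h m1 m2)))) g =
  rexp t1 g1 * rexp t2 g2.
Proof.
move=> gh; rewrite rexp_bind -rexp_mulr; apply: eq_rexp => m1.
by rewrite rexp_bind -rexp_mull; apply: eq_rexp => m2 /=.
Qed.

Lemma arun_prod M1 M2 (A : state_alg M1) (B : state_alg M2) m s :
  arun (prod_alg A B) m s = arun A m.1 s * arun B m.2 s.
Proof.
elim: s m => [|e s IH] m; cbn [arun]; apply: rexp_pair.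
  by case=> -[]; rewrite ?mul1r ?mul0r.
by move=> m1 m2; rewrite IH.
Qed.

Lemma aaccept_prod M1 M2 (A : state_alg M1) (B : state_alg M2) s :
  aaccept (prod_alg A B) s = aaccept A s * aaccept B s.
Proof. by apply: rexp_pair => m1 m2; rewrite arun_prod. Qed.

Fixpoint pow_state (M : finType) (N : nat) : finType :=
  if N is N'.+1 then (M * pow_state M N')%type else unit.

Fixpoint pow_alg (M : finType) (A : state_alg M) (N : nat) :
    state_alg (pow_state M N) :=
  match N return state_alg (pow_state M N) with
  | 0 => {| a_init := RRet tt; a_step m _ := RRet m; a_out _ := RRet true |}
  | N'.+1 => prod_alg A (pow_alg A N')
  end.

Lemma aaccept_pow (M : finType) (A : state_alg M) N s :
  aaccept (pow_alg A N) s = aaccept A s ^+ N.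
Proof.
elim: N => [|N IH]; last by rewrite exprS -IH -aaccept_prod.
by rewrite expr0 /aaccept /=; elim: s => //= e s IH.
Qed.

Lemma card_pow_state (M : finType) N : #|pow_state M N| = (#|M| ^ N)%N.
Proof. by elim: N => [|N IH] /=; rewrite ?card_unit // card_prod IH expnS. Qed.

Section Encode.
Variables (M : finType) (q : nat) (small : (#|M| <= #|{: memory n q}|)%N).

Definition encode (m : M) : memory n q :=
  enum_val (widen_ord small (enum_rank m)).

Lemma encode_inj : injective encode.
Proof.
move=> m m' /enum_val_inj /(congr1 val) /= /ord_inj; exact: enum_rank_inj.
Qed.

Definition decode (x : memory n q) : option M := [pick m | encode m == x].

Lemma encodeK : pcancel encode decode.
Proof.
move=> m; rewrite /decode; case: pickP => [m' /eqP /encode_inj -> //|].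
by move=> /(_ m); rewrite eqxx.
Qed.

(** A run starts in the image of [encode] and stays there; at other memories the functions take
    default values. *)
Definition encode_alg (A : state_alg M) : stream_alg n q :=
  {| s_init := rbind (a_init A) (fun m => RRet (encode m));
     s_step x e := if decode x is Some m
       then rbind (a_step A m e) (fun m' => RRet (encode m')) else RRet x;
     s_out x := if decode x is Some m then a_out A m else RRet true |}.

Lemma run_encode (A : state_alg M) m s :
  run_accept (encode_alg A) (encode m) s = arun A m s.
Proof.
elim: s m => [|e s IH] m /=; rewrite encodeK // rexp_bind.
by apply: eq_rexp => m' /=.
Qed.

Lemma saccept_encode (A : state_alg M) (E : {set edge n}) :
  saccept (encode_alg A) E =
  (\sum_(s <- permutations (enum E)) aaccept A s) / ((#|E|)`!)%:R.
Proof.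
congr (_ / _); apply: eq_bigr => s _; rewrite /aaccept /= rexp_bind.
by apply: eq_rexp => m; rewrite /= run_encode.
Qed.

End Encode.

Lemma card_memory q : #|{: memory n q}| = ((n + n * n).+1 ^ q)%N.
Proof.
by rewrite card_tuple card_option card_sum card_prod card_ord.
Qed.

Definition store_alg (acc : {set edge n} -> bool) : state_alg {set edge n} :=
  {| a_init := RRet set0; a_step S e := RRet (e |: S); a_out S := RRet (acc S) |}.

Lemma aaccept_store acc s :
  aaccept (store_alg acc) s = (acc [set e in s])%:R.
Proof.
rewrite /aaccept /=.
suff H S : arun (store_alg acc) S s = (acc (S :|: [set e in s]))%:R.
  by rewrite H set0U.
elim: s S => [|e s IH] S /=.
  have -> : [set e : edge n in [::]] = set0 by apply/setP=> e; rewrite !inE.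
  by rewrite setU0; case: acc.
by rewrite IH; congr (acc _)%:R; apply/setP=> x; rewrite !inE; case: eqP => //=; rewrite orbT.
Qed.

(** Memory can distinguish all [2 ^ (n * n)] edge sets, so the whole graph is kept and [P] is
    decided classically at the end. *)
Lemma store_testable (P : {set edge n} -> Prop) q :
  (2 ^ (n * n) <= (n + n * n).+1 ^ q)%N ->
  exists A : stream_alg n q, forall E : {set edge n},
    saccept A E = (`[< P E >])%:R :> R.
Proof.
move=> small.
have sm : (#|{set edge n}| <= #|{: memory n q}|)%N.
  by rewrite card_memory -cardsT -powersetT card_powerset cardsT card_prod card_ord.
exists (encode_alg sm (store_alg (fun E => `[< P E >]))) => {}E.
rewrite saccept_encode (eq_big_seq (fun=> (`[< P E >])%:R)) => [|s].
  rewrite big_const_seq count_predT size_permutations ?enum_uniq //.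
  rewrite iter_addr_0 -cardE -[_ *+ _]mulr_natr mulfK // pnatr_eq0 -lt0n.
  exact: fact_gt0.
rewrite mem_permutations => /perm_mem sE; rewrite aaccept_store.
congr (`[< P _ >])%:R; apply/setP => e; rewrite inE sE mem_enum //.
Qed.

End StateAlgorithms.

(** * Canonical explorations *)

Section Explorer.
Variables (R : realType) (n L : nat) (cert : seq 'I_n -> seq (edge n) -> bool).
Variable E : {set edge n}.
Implicit Types (xs : seq 'I_n) (P Q : seq (edge n)) (op : option 'I_L).

Definition ends P : seq 'I_n := flatten [seq [:: e.1; e.2] | e <- P].

Definition touches (v : 'I_n) (e : edge n) : bool := (v == e.1) || (v == e.2).

(* The op [None] queries all edges, [Some i] those at the i-th known vertex. *)
Definition hits xs P op (e : edge n) : bool :=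
  if op is Some i then
    (if onth (xs ++ ends P) i is Some v then touches v e else false)
  else true.

Definition cand xs P op : {set edge n} := [set e in E | hits xs P op e].

(* One exploration step stops at a certificate; otherwise it draws an op and a
   uniform candidate edge. Rediscovered edges are dropped, so mass may be lost. *)
Definition extend xs (g : seq (edge n) -> R) P : R :=
  if cert xs P then g P else
  (\sum_op (\sum_(e in cand xs P op | e \notin P) g (rcons P e))
     / #|cand xs P op|%:R) / L.+1%:R.

Definition explore r xs g P : R := iter r (extend xs) g P.

Lemma exploreS r xs g P : explore r.+1 xs g P = extend xs (explore r xs g) P.
Proof. by []. Qed.

Lemma exploreSr r xs g P : explore r.+1 xs g P = explore r xs (extend xs g) P.
Proof. by rewrite /explore iterSr. Qed.

Definition view_ok P : bool := uniq P && all (mem E) P.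

Lemma view_ok_rcons P e :
  view_ok (rcons P e) = [&& e \in E, e \notin P & view_ok P].
Proof.
rewrite /view_ok rcons_uniq all_rcons /=.
by case: (e \in E); case: (e \in P); rewrite /= ?andbF.
Qed.

Lemma le_extend xs g h P :
  view_ok P -> g P <= h P ->
  (forall e, view_ok (rcons P e) -> g (rcons P e) <= h (rcons P e)) ->
  extend xs g P <= extend xs h P.
Proof.
move=> Pok gh ghe; rewrite /extend; case: ifP => // _.
rewrite ler_wpM2r ?invr_ge0 //; apply: ler_sum => op _.
rewrite ler_wpM2r ?invr_ge0 //; apply: ler_sum => e /andP[].
rewrite inE => /andP[eE _] eP; apply: ghe.
by rewrite view_ok_rcons eE eP.
Qed.

Lemma le_explore r xs g h P :
  view_ok P ->
  (forall Q, view_ok (P ++ Q) -> (size Q <= r)%N -> g (P ++ Q) <= h (P ++ Q)) ->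
  explore r xs g P <= explore r xs h P.
Proof.
elim: r P => [|r IH] P Pok gh; first by move: (gh [::]); rewrite cats0; apply.
rewrite !exploreS; apply: le_extend => // [|e Peok]; apply: IH => // Q Qok Qr.
  by apply: gh => //; rewrite ltnW.
by rewrite cat_rcons; apply: gh; rewrite // -cat_rcons.
Qed.

Lemma le_explore_ext r xs g h P :
  (forall Q, g (P ++ Q) <= h (P ++ Q)) -> explore r xs g P <= explore r xs h P.
Proof.
elim: r P => [|r IH] P gh; first by move: (gh [::]); rewrite cats0.
rewrite !exploreS /extend; case: ifP => _; first exact: IH.
rewrite ler_wpM2r ?invr_ge0 //; apply: ler_sum => op _.
rewrite ler_wpM2r ?invr_ge0 //; apply: ler_sum => e _.
by apply: IH => Q; rewrite cat_rcons.
Qed.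

Lemma eq_explore r xs g h P : g =1 h -> explore r xs g P = explore r xs h P.
Proof.
move=> gh; elim: r P => [|r IH] P; first exact: gh.
rewrite !exploreS /extend; case: ifP => _; first exact: IH.
congr (_ / _); apply: eq_bigr => op _; congr (_ / _).
by apply: eq_bigr => e _; apply: IH.
Qed.

Lemma explore_lin r xs g h a P :
  explore r xs (fun Q => a * g Q + h Q) P = a * explore r xs g P + explore r xs h P.
Proof.
elim: r P => [//|r IH] P; rewrite !exploreS /extend; case: ifP => _; first exact: IH.
rewrite mulrA -mulrDl; congr (_ / _); rewrite mulr_sumr -big_split /=.
apply: eq_bigr => op _; rewrite mulrA -mulrDl; congr (_ / _).
by rewrite mulr_sumr -big_split /=; apply: eq_bigr => e _; apply: IH.
Qed.

Lemma explore0 r xs P : explore r xs (fun=> 0) P = 0.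
Proof.
elim: r P => [//|r IH] P; rewrite exploreS /extend; case: ifP => _; first exact: IH.
rewrite big1 ?mul0r // => op _; rewrite big1 ?mul0r // => e _; exact: IH.
Qed.

Lemma exploreD r xs g h P :
  explore r xs (fun Q => g Q + h Q) P = explore r xs g P + explore r xs h P.
Proof.
rewrite -[X in X + _]mul1r -explore_lin; apply: eq_explore => Q; by rewrite mul1r.
Qed.

Lemma explore_mull r xs g a P :
  explore r xs (fun Q => a * g Q) P = a * explore r xs g P.
Proof.
rewrite -[RHS]addr0 -[X in _ + X](explore0 r xs P) -explore_lin.
by apply: eq_explore => Q; rewrite addr0.
Qed.

Lemma explore_sum I (s : seq I) (p : pred I) r xs (g : I -> seq (edge n) -> R) P :
  explore r xs (fun Q => \sum_(i <- s | p i) g i Q) P =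
  \sum_(i <- s | p i) explore r xs (g i) P.
Proof.
elim: s => [|i s IH].
  by rewrite big_nil -[RHS](explore0 r xs P); apply: eq_explore => Q; rewrite big_nil.
rewrite big_cons -IH -exploreD.
case: (boolP (p i)) => pi; last first.
  by apply: eq_explore => Q; rewrite big_cons (negPf pi).
by rewrite -?exploreD; apply: eq_explore => Q; rewrite big_cons pi.
Qed.

Lemma explore_ge0 r xs g P : (forall Q, 0 <= g Q) -> 0 <= explore r xs g P.
Proof.
move=> g0; elim: r P => [|r IH] P; first exact: g0.
rewrite exploreS /extend; case: ifP => _; first exact: IH.
apply: divr_ge0 => //; apply: sumr_ge0 => op _; apply: divr_ge0 => //.
by apply: sumr_ge0.
Qed.

Lemma card_op : #|{: option 'I_L}| = L.+1.
Proof. by rewrite card_option card_ord. Qed.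

Lemma avg_op_le (F : option 'I_L -> R) a :
  (forall op, F op <= a) -> (\sum_op F op) / L.+1%:R <= a.
Proof.
move=> Fa; rewrite ler_pdivrMr ?ltr0n //.
apply: (le_trans (ler_sum _ (fun op _ => Fa op))).
by rewrite sumr_const card_op mulr_natr.
Qed.

Lemma avg_set_le (S : {set edge n}) (p : pred (edge n)) (F : edge n -> R) a :
  0 <= a -> (forall e, F e <= a) ->
  (\sum_(e in S | p e) F e) / #|S|%:R <= a.
Proof.
move=> a0 Fa; have [->|S0] := eqVneq S set0.
  by rewrite cards0 invr0 mulr0.
rewrite ler_pdivrMr ?ltr0n ?card_gt0 //.
apply: (le_trans (ler_sum _ (fun e _ => Fa e))).
rewrite sumr_const -[_ *+ _]mulr_natr ler_wpM2l // ler_nat.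
by apply: subset_leq_card; apply/subsetP => e /andP[].
Qed.

Lemma explore_le r xs g P a : 0 <= a -> (forall Q, g Q <= a) -> explore r xs g P <= a.
Proof.
move=> a0 ga; elim: r P => [|r IH] P; first exact: ga.
rewrite exploreS /extend; case: ifP => _; first exact: IH.
by apply: avg_op_le => op; apply: avg_set_le.
Qed.

Lemma explore_vanish r xs g P :
  (forall Q, g (P ++ Q) = 0) -> explore r xs g P = 0.
Proof.
elim: r P => [|r IH] P g0; first by rewrite -(g0 [::]) cats0.
rewrite exploreS /extend; case: ifP => _; first exact: IH.
rewrite big1 ?mul0r // => op _; rewrite big1 ?mul0r // => e _.
by apply: IH => Q; rewrite cat_rcons.
Qed.

Lemma explore_cert r xs P :
  cert xs P -> explore r xs (fun Q => (cert xs Q)%:R) P = 1.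
Proof.
by move=> cP; elim: r => [|r IH]; rewrite ?exploreS /= /extend ?cP //= cP.
Qed.

End Explorer.

(** * Reservoir sampling of explorations *)

Section Reservoir.
Variables (R : realType) (n L B : nat).
Implicit Types (xs : seq 'I_n) (P s : seq (edge n)) (op : option 'I_L).

(* The state of [r] nested exploration steps: the op of the first one and, once
   a candidate edge has arrived, the sampled edge, the number of candidates so
   far (at most [B]), and the state of the remaining steps. *)
Fixpoint level (r : nat) : finType :=
  if r is r'.+1 then
    (option 'I_L * option (edge n * 'I_B.+1 * level r'))%type
  else unit.

Fixpoint level_init (r : nat) : rtree (level r) :=
  match r return rtree (level r) with
  | 0 => RRet tt
  | r'.+1 => rbind (runif (None : option 'I_L)) (fun op => RRet (op, None))
  end.

(* Reservoir sampling: the [c+1]-st candidate replaces the stored one with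
   probability [1/(c+1)], which restarts the deeper steps. *)
Fixpoint level_step (r : nat) xs P (f : edge n) : level r -> rtree (level r) :=
  match r return level r -> rtree (level r) with
  | 0 => fun st => RRet st
  | r'.+1 => fun st =>
    let: (op, o) := st in
    let h := hits xs P op f in
    match o with
    | None => if h
        then rbind (level_init r') (fun st0 => RRet (op, Some (f, inord 1, st0)))
        else RRet (op, None)
    | Some (e, c, st1) => if h
        then @RRand _ c (fun i : 'I_c.+1 => if i == ord0
          then rbind (level_init r') (fun st0 => RRet (op, Some (f, inord c.+1, st0)))
          else rbind (level_step xs (rcons P e) f st1)
                 (fun st2 => RRet (op, Some (e, inord c.+1, st2))))
        else rbind (level_step xs (rcons P e) f st1)
               (fun st2 => RRet (op, Some (e, c, st2)))
    end
  end.

Fixpoint level_view (r : nat) P : level r -> seq (edge n) :=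
  match r return level r -> seq (edge n) with
  | 0 => fun _ => P
  | r'.+1 => fun st =>
      if st.2 is Some (e, _, st1) then level_view (rcons P e) st1 else P
  end.

Fixpoint level_run r xs P (g : seq (edge n) -> R) s (st : level r) : R :=
  if s is f :: s' then
    rexp (level_step xs P f st) (level_run xs P g s')
  else g (level_view P st).

Definition level_exp r xs P (g : seq (edge n) -> R) s : R :=
  rexp (level_init r) (level_run xs P g s).

(** Ranges over the decompositions [s1 ++ f :: s2] of the stream with [h f]: here [f] is the final
    sample of a reservoir, and [s2] is the part of the stream seen by the deeper steps. *)
Fixpoint sum_splits (h : pred (edge n)) (F : edge n -> seq (edge n) -> R) s : R :=
  if s is f :: s' then (if h f then F f s' else 0) + sum_splits h F s' else 0.

(** Reservoir sampling: the stored edge stands for [c] past candidates, each later candidate for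
    itself, and all are equally likely to be the final sample. Multiplying by the number of
    candidates keeps the induction free of division. *)
Lemma level_run_stored r xs P g op e (c : 'I_B.+1) (st : level r) s :
  (0 < c)%N -> (c + size s <= B)%N ->
  (c + count (hits xs P op) s)%:R
    * @level_run r.+1 xs P g s (op, Some (e, c, st)) =
  c%:R * level_run xs (rcons P e) g s st
  + sum_splits (hits xs P op) (fun f => level_exp r xs (rcons P f) g) s.
Proof.
elim: s e c st => [|f s IH] e c st c0 cB; first by rewrite addn0 addr0.
rewrite [count _ _]/= [sum_splits _ _ _]/= [in LHS]/=.
rewrite /= in cB; case: ifP => hf; last first.
  rewrite !add0n add0r rexp_bind -rexp_mull.
  rewrite -[X in _ = _ + X](rexp_const (level_step xs (rcons P e) f st)) -rexp_lin; apply: eq_rexp => st2; apply: IH => //.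
  by rewrite (leq_trans _ cB) // leq_add2l.
(* Past [B], [inord] would fall back to 0; the bound on [c + size s] excludes this. *)
have vc : (inord c.+1 : 'I_B.+1) = c.+1 :> nat.
  by rewrite inordK // ltnS (leq_trans _ cB) // addnS ltnS leq_addr.
set N := count _ _; set SP := sum_splits _ _ _; set W := level_exp _ _ _ _ _.
rewrite add1n addnS -addSn; cbn [rexp level_run]; rewrite big_ord_recl.
cbn [eq_op]; rewrite eqxx.
rewrite (eq_bigr (fun=> rexp (level_step xs (rcons P e) f st) (fun st2 =>
    @level_run r.+1 xs P g s (op, Some (e, inord c.+1, st2))))); last first.
  by move=> i _; rewrite rexp_bind.
rewrite sumr_const card_ord -[_ *+ c]mulr_natl rexp_bind /=.
have e1 : (c.+1 + N)%:R * rexp (level_init r) (fun st0 =>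
    @level_run r.+1 xs P g s (op, Some (f, inord c.+1, st0))) = c.+1%:R * W + SP.
  rewrite -rexp_mull -[X in _ + X](rexp_const (level_init r)) -rexp_lin.
  apply: eq_rexp => st0; rewrite -{1 3}vc; apply: IH; rewrite vc //.
  by rewrite addSn -addnS.
have e2 : (c.+1 + N)%:R * rexp (level_step xs (rcons P e) f st) (fun st2 =>
    @level_run r.+1 xs P g s (op, Some (e, inord c.+1, st2))) =
    c.+1%:R * rexp (level_step xs (rcons P e) f st) (level_run xs (rcons P e) g s) + SP.
  rewrite -rexp_mull -[X in _ + X](rexp_const (level_step xs (rcons P e) f st)) -rexp_lin.
  apply: eq_rexp => st0; rewrite -{1 3}vc; apply: IH; rewrite vc //.
  by rewrite addSn -addnS.
(* One of the [c + 1] coin values contributes [e1], the other [c] contribute [e2]. After division by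
   [c + 1], the new sample has weight 1, the stored one weight [c], and [SP] weight 1. *)
rewrite mulrA mulrDr e1 mulrCA e2.
have c1 : c.+1%:R != 0 :> R by rewrite pnatr_eq0.
by rewrite -[c.+1]addn1 natrD in c1 *; field.
Qed.

(** The first candidate is stored with counter 1, and [level_run_stored] takes over from there. *)
Lemma level_run_empty r xs P g op s :
  (size s <= B)%N ->
  (count (hits xs P op) s)%:R * @level_run r.+1 xs P g s (op, None) =
  sum_splits (hits xs P op) (fun f => level_exp r xs (rcons P f) g) s.
Proof.
elim: s => [|f s IH] sB; first by rewrite mul0r.
rewrite [count _ _]/= [sum_splits _ _ _]/= [in LHS]/=.
rewrite /= in sB; case: ifP => hf; last by rewrite !add0n add0r IH // ltnW.
have v1 : (inord 1 : 'I_B.+1) = 1%N :> nat by rewrite inordK // ltnS (leq_trans _ sB).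
rewrite rexp_bind -rexp_mull.
rewrite -[X in _ + X](rexp_const (level_init r)) -[X in X + _]mul1r /level_exp -rexp_lin.
apply: eq_rexp => st0; rewrite -[true : nat]/1%N -{1}v1.
by rewrite level_run_stored v1 // mul1r.
Qed.

Lemma level_run_unhit r xs P g op s :
  count (hits xs P op) s = 0%N -> @level_run r.+1 xs P g s (op, None) = g P.
Proof.
by elim: s => [//|f s IH] /=; case: ifP.
Qed.

End Reservoir.

Section ReservoirBound.
Variables (R : realType) (n L B : nat).
Implicit Types (xs : seq 'I_n) (P Q s : seq (edge n)) (op : option 'I_L).

Lemma le_sum_splits (h : pred (edge n)) (X : edge n -> R) F s :
  (forall s1 f s2, s = s1 ++ f :: s2 -> h f -> X f <= F f s2) ->
  \sum_(f <- s | h f) X f <= sum_splits h F s.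
Proof.
elim: s => [|f s IH] XF; first by rewrite big_nil.
have IHs : \sum_(f0 <- s | h f0) X f0 <= sum_splits h F s.
  by apply: IH => s1 g s2 sE; apply: (XF (f :: s1)); rewrite sE.
rewrite big_cons /=; case: ifP => hf; last by rewrite add0r.
by apply: lerD => //; apply: (XF [::]).
Qed.

Lemma level_view_ext r P (st : level n L B r) : exists Q, level_view P st = P ++ Q.
Proof.
elim: r P st => [|r IH] P st /=; first by exists [::]; rewrite cats0.
case: st => op [[[e c] st1]|] /=; last by exists [::]; rewrite cats0.
by have [Q ->] := IH (rcons P e) st1; exists (e :: Q); rewrite cat_rcons.
Qed.

Variables (E : {set edge n}) (cert : seq 'I_n -> seq (edge n) -> bool).
Hypothesis cert_ext : forall xs P Q, cert xs P -> cert xs (P ++ Q).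

(** The exploration stops at a certificate while the stream goes on sampling. This does no harm,
    since the view only extends [P] and certificates survive extension. *)
Lemma level_run_certified r xs P s (st : level n L B r) :
  cert xs P -> level_run xs P (fun Q => (cert xs Q)%:R) s st = 1 :> R.
Proof.
move=> cP; elim: s st => [|f s IH] st /=.
  by have [Q ->] := level_view_ext P st; rewrite cert_ext.
by rewrite (eq_rexp _ (fun st' => IH st')) rexp_const.
Qed.

Lemma level_run0 xs P (g : seq (edge n) -> R) s (st : level n L B 0) :
  level_run xs P g s st = g P.
Proof. by elim: s. Qed.

(* The payload only counts explorations whose edges arrive in exploration order:
   then no edge queried at some step can have arrived before that step began. *)
Lemma explore_le_level_exp r xs P s :
  uniq s -> {subset s <= E} -> (size s <= B)%N ->
  explore L cert E r xs
    (fun Q => (cert xs Q && subseq (drop (size P) Q) s)%:R) P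
  <= level_exp L B r xs P (fun Q => (cert xs Q)%:R) s :> R.
Proof.
elim: r P s => [|r IH] P s us sE sB.
  rewrite /level_exp /= level_run0 /explore /=.
  by case: (cert xs P); case: (subseq _ _).
have [cP|ncP] := boolP (cert xs P).
  rewrite /level_exp (eq_rexp _ (fun st => level_run_certified _ _ cP)) rexp_const.
  by apply: explore_le => // Q; case: (_ && _).
rewrite exploreS /extend (negPf ncP) /level_exp; cbn [level_init].
rewrite rexp_bind rexp_unif card_op ler_wpM2r ?invr_ge0 //.
apply: ler_sum => op _; cbn [rexp].
set h := (fun Q => _ : R); set X := fun e => explore L cert E r xs h (rcons P e).
set N := count (hits xs P op) s.
have X0 e : 0 <= X e by apply: explore_ge0 => Q; apply: ler0n.
(* An edge that does not arrive in [s] cannot be part of an exploration found in order. *)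
have Xs e : e \notin s -> X e = 0.
  move=> es; apply: explore_vanish => Q; rewrite /h cat_rcons drop_size_cat //.
  case: (boolP (subseq _ _)) => [sub|]; last by rewrite andbF.
  by case/negP: es; apply: (mem_subseq sub); rewrite mem_head.
have [N0|N0] := posnP N.
  rewrite level_run_unhit // big1 ?mul0r // => e.
  rewrite inE => /andP[/andP[eE he] eP]; apply: Xs; apply/negP => es.
  by move/eqP: N0; rewrite -leqn0 leqNgt -has_count; case/negP; apply/hasP; exists e.
have S0 : (0 < N%:R :> R) by rewrite ltr0n.
have Ncand : (N <= #|cand E xs P op|)%N.
  rewrite /N -size_filter cardE uniq_leq_size ?filter_uniq // => e.
  by rewrite mem_filter mem_enum inE => /andP[-> /sE ->].
have C0 : (0 < #|cand E xs P op|%:R :> R) by rewrite ltr0n (leq_trans N0).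
rewrite -(ler_pM2l S0) level_run_empty //.
(* The comparison of denominators: the exploration divides by all candidates in [E], the reservoir
   only by the [N] of them that arrive in [s]. *)
apply: (@le_trans _ _ (\sum_(e in cand E xs P op | e \notin P) X e)).
  rewrite mulrCA; apply: ler_piMr; first by apply: sumr_ge0 => e _; apply: X0.
  by rewrite ler_pdivrMr // mul1r ler_nat.
apply: (@le_trans _ _ (\sum_(f <- s | hits xs P op f) X f)).
  rewrite (bigID (mem s)) /= [X in _ + X]big1 ?addr0 => [|e /andP[_ /Xs //]].
  rewrite -[X in _ <= X]big_filter big_uniq ?filter_uniq //=.
  rewrite big_mkcond [X in _ <= X]big_mkcond /=.
  apply: ler_sum => e _; rewrite mem_filter inE.
  by case: (e \in E); case: (hits _ _ _ _); case: (e \in P); case: (e \in s) => /=.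
apply: le_sum_splits => s1 f s2 sE12 hf.
move: (us); rewrite sE12 cat_uniq => /and3P[_ /hasPn s1s2 /= /andP[fs2 us2]].
have s2s : {subset s2 <= s} by move=> e es; rewrite sE12 mem_cat inE es !orbT.
apply: (le_trans _ (IH (rcons P f) s2 us2 _ _)); last 2 first.
- by move=> e /s2s /sE.
- by rewrite (leq_trans _ sB) // sE12 size_cat /= addnS ltnW // ltnS leq_addl.
apply: le_explore_ext => Q.
rewrite /h cat_rcons drop_size_cat // -cat_rcons drop_size_cat //.
case: (cert _ _) => //=; rewrite ler_nat.
(* The order is duplicate-free, so [f] can only be matched right before [s2], and [Q] has to follow
   it. *)
suff: subseq (f :: Q) s -> subseq Q s2 by case: (subseq _ s) => // ->.
rewrite sE12; have: f \notin s1 by apply: s1s2; apply: mem_head.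
elim: s1 {sE12 s1s2} => [|a s1 IHs] /=; first by rewrite eqxx.
by rewrite inE negb_or => /andP[/negPf -> fs1]; apply: IHs.
Qed.

End ReservoirBound.

(** * The streaming tester *)

Section TesterAlgorithm.
Variables (R : realType) (n k L B : nat).
Variables (v0 : 'I_n) (certI : seq 'I_n -> seq (edge n) -> bool).
Implicit Types (s : seq (edge n)).

(* Each sampled vertex carries a flag telling that no edge has touched it so far. *)
Definition tester_state : finType := (k.-tuple ('I_n * bool) * level n L B k)%type.

Definition flag_start (v : 'I_n) : 'I_n * bool := (v, true).

Definition flag_step (e : edge n) (p : 'I_n * bool) : 'I_n * bool :=
  (p.1, p.2 && ~~ touches p.1 e).

Definition flagged (t : seq ('I_n * bool)) : seq 'I_n := [seq p.1 | p <- t & p.2].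

Definition tester : state_alg n tester_state :=
  {| a_init := rbind (runif_tuple v0 k) (fun xs =>
       rbind (level_init n L B k) (fun st => RRet (map_tuple flag_start xs, st)));
     a_step m e :=
       rbind (level_step [seq p.1 | p <- m.1] [::] e m.2)
         (fun st => RRet (map_tuple (flag_step e) m.1, st));
     a_out m := RRet (~~ certI (flagged m.1) (level_view [::] m.2)) |}.

Definition untouched s (xs : seq 'I_n) : seq 'I_n :=
  [seq v <- xs | all (fun e => ~~ touches v e) s].

(** The flags left at the end single out the vertices that the rest of the stream does not touch
    either. *)
Lemma arun_tester (m : tester_state) s :
  arun R tester m s =
  1 - level_run [seq p.1 | p <- m.1] [::]
        (fun Q => (certI (untouched s (flagged m.1)) Q)%:R) s m.2.
Proof.
elim: s m => [|e s IH] [t st] /=.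
  have -> : untouched [::] (flagged t) = flagged t by apply/all_filterP/allP.
  by case: (certI _ _); rewrite /= ?subrr ?subr0.
rewrite rexp_bind -rexp_1B; apply: eq_rexp => st' /=; rewrite IH /=.
have -> : [seq p.1 | p <- map (flag_step e) t] = [seq p.1 | p <- t].
  by rewrite -map_comp.
suff -> : untouched s (flagged (map (flag_step e) t)) = untouched (e :: s) (flagged t).
  by [].
rewrite /untouched /flagged; elim: (tval t) => [//|[v b] t' IHt] /=.
case: b => //=; case: (touches v e) => //=.
by case: ifP => //= _; rewrite IHt.
Qed.

Lemma aaccept_tester s :
  aaccept R tester s =
  avg_seq k (fun xs => 1 -
    level_exp L B k xs [::] (fun Q => (certI (untouched s xs) Q)%:R) s).
Proof.
rewrite /aaccept /= rexp_bind -(rexp_unif_tuple v0).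
apply: eq_rexp => t; rewrite rexp_bind -rexp_1B; apply: eq_rexp => st.
rewrite [LHS]arun_tester /= -map_comp map_id.
suff -> : flagged (map flag_start t) = t by [].
rewrite /flagged; elim: (tval t) => [//|v t' IHt] /=; by rewrite IHt.
Qed.

End TesterAlgorithm.

(** * The number of words used by the tester *)

Section StateSize.
Variables (n k L : nat).

(** Each step costs one word for the op, one for the edge, one for the counter, and one that absorbs
    the extra value [None]. *)
Lemma card_level r : (L < (n + n * n).+1)%N ->
  (#|level n L (n * n) r| <= (n + n * n).+1 ^ (4 * r))%N.
Proof.
set W := (n + n * n).+1 => LW.
elim: r => [|r IH] /=; first by rewrite card_unit.
rewrite card_prod card_op card_option !card_prod !card_ord (mulnS 4) expnD.
set x := #|_| in IH *; set y := (W ^ _)%N in IH *.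
have y0 : (0 < y)%N by rewrite expn_gt0.
have W4 : (W ^ 4 = W * (W * W * W))%N by rewrite !expnS muln1 !mulnA.
rewrite W4 -[leqRHS]mulnA leq_mul //.
have [n0|n1] := posnP n; first by rewrite n0 !mul0n !muln_gt0 y0.
have W2 : (2 <= W)%N by rewrite /W ltnS addn_gt0 n1.
have z0 : (0 < W * W * y)%N by rewrite !muln_gt0 y0.
apply: (@leq_trans (W * W * y).+1).
  rewrite ltnS leq_mul // leq_mul // /W ?ltnS ?leq_addl //.
  by rewrite ltnW // ltnS leq_addl.
rewrite -[(W * W * W * y)%N]mulnA [(W * y)%N]mulnC mulnA.
by apply: (@leq_trans ((W * W * y) * 2)); [lia | rewrite leq_mul2l W2 orbT].
Qed.

(** Two words for each sampled vertex and its flag, four for each exploration step. *)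
Lemma card_tester_state : (0 < n)%N -> (L < (n + n * n).+1)%N ->
  (#|tester_state n k L (n * n)| <= (n + n * n).+1 ^ (6 * k))%N.
Proof.
move=> n0 LW; rewrite card_prod card_tuple card_prod card_ord card_bool.
have -> : (6 * k = 2 * k + 4 * k)%N by rewrite -mulnDl.
rewrite expnD leq_mul ?card_level // expnM.
have [->|k0] := posnP k; first by [].
rewrite leq_exp2r // expnS expn1 leq_mul //; first by rewrite ltnW // ltnS leq_addr.
by rewrite ltnS addn_gt0 n0.
Qed.
End StateSize.

(** * Random orders *)

Section RandomOrder.
Variable T : finType.
Implicit Types (l P Q s : seq T).

(** For lists of equal size, the default [x] of [nth] makes this the identity outside [P]. *)
Definition transport P Q (x : T) : T := nth x Q (index x P).

Lemma map_transport P Q : uniq P -> size P = size Q -> map (transport P Q) P = Q.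
Proof.
move=> uP sPQ; case: P uP sPQ => [|x0 P'] uP sPQ; first by case: Q sPQ.
set P := x0 :: P' in uP sPQ *.
apply: (@eq_from_nth _ x0); rewrite size_map // => i iP.
rewrite (nth_map x0) // /transport index_uniq //.
by apply: set_nth_default; rewrite -sPQ.
Qed.

Lemma transport_inj P Q : uniq P -> perm_eq P Q -> injective (transport P Q).
Proof.
move=> uP PQ; have sPQ := perm_size PQ; have mPQ := perm_mem PQ.
have uQ : uniq Q by rewrite -(perm_uniq PQ).
have out x : x \notin P -> transport P Q x = x.
  by move=> xP; rewrite /transport nth_default // -sPQ leqNgt index_mem.
have inQ x : x \in P -> transport P Q x \in P.
  by move=> xP; rewrite mPQ mem_nth // -sPQ index_mem.
move=> x y; have [xP|xP] := boolP (x \in P); have [yP|yP] := boolP (y \in P).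
- move: (xP) (yP); rewrite -!index_mem sPQ => xi yi.
  rewrite /transport (set_nth_default x y) // => /eqP.
  rewrite nth_uniq // => /eqP xy.
  by rewrite -(nth_index x xP) xy nth_index.
- by rewrite (out y) // => xy; move: (inQ _ xP); rewrite xy (negPf yP).
- by rewrite (out x) // => xy; move: (inQ _ yP); rewrite -xy (negPf xP).
- by rewrite !out.
Qed.

Lemma subseq_map_inj (f : T -> T) s1 s2 :
  injective f -> subseq (map f s1) (map f s2) = subseq s1 s2.
Proof.
move=> fI; elim: s2 s1 => [|y s2 IH] [|x s1] //=.
by rewrite (inj_eq fI); case: ifP => _; rewrite ?IH // -IH.
Qed.

Definition in_order l P Q : nat :=
  count (fun s => subseq P s && subseq Q s) (permutations l).

(** By symmetry: [transport] permutes the elements of [l], hence its orders, and carries [P] to [P']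
    and [Q] to [Q']. *)
Lemma in_order_perm l P Q P' Q' :
  uniq l -> uniq (P ++ Q) -> {subset P ++ Q <= l} ->
  perm_eq P P' -> perm_eq Q Q' -> in_order l P Q = in_order l P' Q'.
Proof.
move=> ul uPQ sub PP' QQ'.
set g := transport (P ++ Q) (P' ++ Q').
have gI : injective g by apply: transport_inj => //; apply: perm_cat.
have : map g (P ++ Q) = P' ++ Q'.
  by apply: map_transport => //; rewrite !size_cat (perm_size PP') (perm_size QQ').
rewrite map_cat => /eqP; rewrite eqseq_cat ?size_map ?(perm_size PP') //.
move=> /andP[/eqP gP /eqP gQ].
have gl : perm_eq (map g l) l.
  apply: uniq_perm => //; first by rewrite map_inj_uniq.
  have sgl : {subset map g l <= l}.
    move=> _ /mapP[x xl ->]; have [xPQ|xPQ] := boolP (x \in P ++ Q).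
      apply: sub; rewrite (perm_mem (perm_cat PP' QQ')) mem_nth //.
      by rewrite -(perm_size (perm_cat PP' QQ')) index_mem.
    rewrite /g /transport nth_default //.
    by rewrite -(perm_size (perm_cat PP' QQ')) leqNgt index_mem.
  by have [] := uniq_min_size _ sgl _; rewrite ?size_map ?map_inj_uniq.
have perms : perm_eq (map (map g) (permutations l)) (permutations l).
  apply: uniq_perm; rewrite ?map_inj_uniq ?permutations_uniq //; first exact: inj_map.
  have sg : {subset map (map g) (permutations l) <= permutations l}.
    move=> _ /mapP[s sl ->]; rewrite mem_permutations in sl.
    by rewrite mem_permutations (perm_trans _ gl) // perm_map.
  have [] // := uniq_min_size _ sg _; rewrite ?size_map ?map_inj_uniq ?permutations_uniq //.
  exact: inj_map.
rewrite /in_order -[RHS](seq.permP perms) count_map; apply: eq_count => s /=.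
by rewrite -gP -gQ !subseq_map_inj.
Qed.

(** The order that [s] induces on [P] is the filter of [s] by membership in [P]. *)
Lemma count_subseq_permutations P s :
  uniq P -> uniq s -> {subset P <= s} ->
  count (fun P' => subseq P' s) (permutations P) = 1%N.
Proof.
move=> uP us sub.
have fP : perm_eq [seq x <- s | x \in P] P.
  apply: uniq_perm; rewrite ?filter_uniq // => x; rewrite mem_filter.
  by case: (boolP (x \in P)) => //= /sub.
rewrite -[RHS]/(true : nat) -(etrans (mem_permutations _ _) fP).
rewrite -count_uniq_mem ?permutations_uniq //; apply: eq_in_count => P'.
rewrite mem_permutations => PP' /=.
apply/idP/eqP => [/(subseq_uniqP us) -> | ->]; last exact: filter_subseq.
by apply: eq_filter => x; rewrite (perm_mem PP').
Qed.

(** Independence of the relative orders of disjoint sets, by double counting. Summed over all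
    rearrangements of [P] and of [Q], the count is constant by symmetry, while each order of [l] is
    counted exactly once. *)
Lemma in_orderE l P Q :
  uniq l -> uniq (P ++ Q) -> {subset P ++ Q <= l} ->
  (in_order l P Q * ((size P)`! * (size Q)`!) = (size l)`!)%N.
Proof.
move=> ul uPQ sub; have /and3P[uP _ uQ] : [&& uniq P, ~~ has [in P] Q & uniq Q].
  by rewrite -cat_uniq.
have subP : {subset P <= l} by move=> x xP; apply: sub; rewrite mem_cat xP.
have subQ : {subset Q <= l} by move=> x xQ; apply: sub; rewrite mem_cat xQ orbT.
transitivity (\sum_(P' <- permutations P) \sum_(Q' <- permutations Q) in_order l P' Q')%N.
  rewrite (eq_big_seq (fun=> (in_order l P Q * (size Q)`!)%N)) => [|P'].
    rewrite big_const_seq count_predT iter_addn_0 size_permutations //.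
    by rewrite -mulnA [((size P)`! * _)%N]mulnC.
  rewrite mem_permutations => PP'.
  rewrite (eq_big_seq (fun=> in_order l P Q)) => [|Q'].
    by rewrite big_const_seq count_predT iter_addn_0 size_permutations.
  rewrite mem_permutations => QQ'.
  by rewrite (@in_order_perm l P Q P' Q') 1?perm_sym.
rewrite -(size_permutations ul) -sum1_size.
under eq_bigr => P' _ do under eq_bigr => Q' _ do rewrite /in_order -sum1_count big_mkcond.
under eq_bigr => P' _ do rewrite exchange_big.
rewrite exchange_big; apply: eq_big_seq => s; rewrite mem_permutations => sl.
have us : uniq s by rewrite (perm_uniq sl).
have sP : {subset P <= s} by move=> x /subP; rewrite (perm_mem sl).
have sQ : {subset Q <= s} by move=> x /subQ; rewrite (perm_mem sl).
rewrite -{2}(count_subseq_permutations uP us sP) -sum1_count [RHS]big_mkcond.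
apply: eq_bigr => P' _ /=; case: ifP => sP' /=; last by rewrite big1_eq.
by rewrite -big_mkcond /= sum1_count count_subseq_permutations.
Qed.

End RandomOrder.

Section OrderProbability.
Variables (R : realType) (T : finType) (A : {set T}).

Definition avg_order (F : seq T -> R) : R :=
  (\sum_(s <- permutations (enum A)) F s) / (#|A|`!)%:R.

Lemma le_avg_order F G :
  (forall s, perm_eq s (enum A) -> F s <= G s) -> avg_order F <= avg_order G.
Proof.
move=> FG; rewrite ler_wpM2r ?invr_ge0 // big_seq [leRHS]big_seq.
by apply: ler_sum => s; rewrite mem_permutations; apply: FG.
Qed.

Lemma avg_order_const a : avg_order (fun=> a) = a.
Proof.
rewrite /avg_order big_const_seq count_predT size_permutations ?enum_uniq //.
rewrite iter_addr_0 -cardE -[_ *+ _]mulr_natr mulfK // pnatr_eq0 -lt0n.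
exact: fact_gt0.
Qed.

Lemma avg_order_lin F G a :
  avg_order (fun s => a * F s + G s) = a * avg_order F + avg_order G.
Proof. by rewrite /avg_order big_split /= -mulr_sumr mulrDl mulrA. Qed.

Lemma avg_order_pair P Q : uniq (P ++ Q) -> {subset P ++ Q <= A} ->
  avg_order (fun s => (subseq P s && subseq Q s)%:R) =
  ((size P)`!%:R)^-1 * ((size Q)`!%:R)^-1.
Proof.
move=> uPQ sub.
have f0 m : m`!%:R != 0 :> R by rewrite pnatr_eq0 -lt0n fact_gt0.
have E : \sum_(s <- permutations (enum A)) ((subseq P s && subseq Q s)%:R : R) =
    (in_order (enum A) P Q)%:R.
  rewrite /in_order -sum1_count [in RHS]big_mkcond natr_sum.
  by apply: eq_bigr => s _; case: (_ && _).
rewrite /avg_order E cardE -(in_orderE (enum_uniq _) uPQ) => [|x /sub]; last first.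
  by rewrite mem_enum.
have : (in_order (enum A) P Q)%:R != 0 :> R.
  apply/negP; rewrite pnatr_eq0 => /eqP N0.
  have := @in_orderE _ (enum A) P Q (enum_uniq _) uPQ _.
  rewrite N0 mul0n => H; move: (fact_gt0 (size (enum A))); rewrite -H // => x /sub.
  by rewrite mem_enum.
rewrite !natrM => N0; field; by rewrite N0 !f0.
Qed.

Lemma avg_order_subseq P : uniq P -> {subset P <= A} ->
  avg_order (fun s => (subseq P s)%:R) = ((size P)`!%:R)^-1.
Proof.
move=> uP sub; rewrite -[RHS]mulr1 -[X in _ * X]invr1 -(@avg_order_pair P [::]) ?cats0 //.
by congr (_ / _); apply: eq_bigr => s _; rewrite sub0seq andbT.
Qed.
End OrderProbability.

(** * Concentration over the random order *)

Section Variance.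
Variables (R : realType) (n L k : nat) (cert : seq 'I_n -> seq (edge n) -> bool).
Variable E : {set edge n}.
Hypothesis n0 : (0 < n)%N.
Implicit Types (xs : seq 'I_n) (P Q : seq (edge n)).

Definition explored r (g : seq 'I_n -> seq (edge n) -> R) : R :=
  avg_seq k (fun xs => explore L cert E r xs (g xs) [::]).

Definition star (v : 'I_n) : {set edge n} := [set e in E | touches v e].

Lemma le_explored r g h :
  (forall xs Q, view_ok E Q -> (size Q <= r)%N -> g xs Q <= h xs Q) ->
  explored r g <= explored r h.
Proof.
by move=> gh; apply: le_avg_seq => xs _; apply: le_explore => // Q; apply: gh.
Qed.

Lemma explored_ge0 r g : (forall xs Q, 0 <= g xs Q) -> 0 <= explored r g.
Proof. by move=> g0; apply: avg_seq_ge0 => xs; apply: explore_ge0. Qed.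

Lemma explored_le r g a : 0 <= a -> (forall xs Q, g xs Q <= a) -> explored r g <= a.
Proof.
move=> a0 ga; rewrite -(@avg_seq_const R 'I_n k a) ?card_ord //.
by apply: le_avg_seq => xs _; apply: explore_le.
Qed.

Lemma eq_explored r g h : (forall xs Q, g xs Q = h xs Q) -> explored r g = explored r h.
Proof. by move=> gh; apply: eq_avg_seq => xs _; apply: eq_explore => Q. Qed.

Lemma explored_mull r g a : explored r (fun xs Q => a * g xs Q) = a * explored r g.
Proof. by rewrite -avg_seq_mull; apply: eq_avg_seq => xs _; rewrite explore_mull. Qed.

Lemma explored_mulr r g a : explored r (fun xs Q => g xs Q * a) = explored r g * a.
Proof. by rewrite mulrC -explored_mull; apply: eq_explored => *; rewrite mulrC. Qed.

Lemma exploredD r g h :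
  explored r (fun xs Q => g xs Q + h xs Q) = explored r g + explored r h.
Proof. by rewrite -avg_seqD; apply: eq_avg_seq => xs _; rewrite exploreD. Qed.

Lemma explored_sum I (s : seq I) (p : pred I) r g :
  explored r (fun xs Q => \sum_(i <- s | p i) g i xs Q) =
  \sum_(i <- s | p i) explored r (g i).
Proof. by rewrite -avg_seq_sum; apply: eq_avg_seq => xs _; rewrite explore_sum. Qed.

Lemma onth_ends Q i u : onth (ends Q) i = Some u -> exists2 e, e \in Q & touches u e.
Proof.
move=> iu; have /flatten_mapP[e eQ] : u \in ends Q by apply/onthP; exists i.
by rewrite !inE => ue; exists e.
Qed.

(** A query at a slot draws from the star of the vertex in it, and can draw [e] only if that vertex
    is one of the two ends of [e]. *)
Lemma avg_cand_le xs Q i e : e \in E ->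
  (e \in cand E xs Q (Some i : option 'I_L))%:R / #|cand E xs Q (Some i)|%:R <=
  \sum_(u <- [:: e.1; e.2]) (onth (xs ++ ends Q) i == Some u)%:R / #|star u|%:R :> R.
Proof.
move=> eE; set T := \sum_(u <- _) _.
have T0 : 0 <= T by apply: sumr_ge0 => u _; apply: divr_ge0.
case: (boolP (e \in cand _ _ _ _)) => [|_]; last by rewrite mul0r.
rewrite inE eE /= /T; case ov: (onth (xs ++ ends Q) i) => [v|] // ve.
have -> : cand E xs Q (Some i : option 'I_L) = star v.
  by apply/setP => f; rewrite !inE /= ov.
rewrite big_cons big_seq1 /=.
by case/orP: ve => /eqP ->; rewrite eqxx; [rewrite lerDl|rewrite lerDr]; apply: divr_ge0.
Qed.

(** A known vertex is a start vertex or an end of an explored edge, and in the latter case that edge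
    lies in its star. *)
Lemma slot_touched xs Q i u : view_ok E Q ->
  (onth (xs ++ ends Q) i == Some u)%:R <=
  (onth xs i == Some u)%:R + \sum_(f in star u) (f \in Q)%:R :> R.
Proof.
move=> /andP[_ /allP QE]; case: eqP => [|_]; last by rewrite addr_ge0 // sumr_ge0.
rewrite onth_cat; case: ifP => _ iu; first by rewrite iu eqxx lerDl sumr_ge0.
have [e eQ ue] := onth_ends iu.
rewrite (bigD1 e) /= ?eQ; last by rewrite inE ue andbT; apply: QE.
by rewrite addrCA lerDl addr_ge0 // sumr_ge0.
Qed.

(* By induction, the law of every known vertex is at most proportional to its degree. *)
Lemma explored_mem r e (a : R) :
  n%:R^-1 <= a -> #|E|%:R^-1 <= a ->
  explored r (fun _ Q => (e \in Q)%:R) <= 5 ^+ r * a.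
Proof.
move=> na Ea; have a0 : 0 <= a by rewrite (le_trans _ na) ?invr_ge0.
elim: r e => [|r IH] e.
  rewrite expr0 mul1r; apply: (le_trans _ a0).
  by rewrite /explored /explore /= avg_seq_const ?card_ord.
have [eE|eE] := boolP (e \in E); last first.
  apply: (@le_trans _ _ (explored r.+1 (fun _ _ => 0))).
    apply: le_explored => xs Q /andP[_ /allP QE] _.
    by case: (boolP (e \in Q)) => // /QE; rewrite /= (negPf eE).
  by apply: explored_le; rewrite ?mulr_ge0 ?exprn_ge0.
set b := 5 ^+ r * a in IH.
have ab : a <= b by rewrite ler_peMl // exprn_ege1 // ler1n.
have b0 : 0 <= b := le_trans a0 ab.
have -> : explored r.+1 (fun _ Q => (e \in Q)%:R) =
    explored r (fun xs => extend L cert E xs (fun Q => (e \in Q)%:R)).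
  by apply: eq_avg_seq => xs _; rewrite exploreSr.
apply: (@le_trans _ _ (explored r (fun xs Q => (e \in Q)%:R +
    (\sum_(op : option 'I_L) (e \in cand E xs Q op)%:R / #|cand E xs Q op|%:R)
      * L.+1%:R^-1))).
  apply: le_explored => xs Q _ _; rewrite /extend.
  have S0 : 0 <= (\sum_(op : option 'I_L) (e \in cand E xs Q op)%:R
      / #|cand E xs Q op|%:R) * L.+1%:R^-1 :> R.
    by apply: mulr_ge0; rewrite ?invr_ge0 // sumr_ge0 // => op _; apply: divr_ge0.
  case: ifP => _; first by rewrite lerDl.
  case: (boolP (e \in Q)) => eQ.
    apply: (@le_trans _ _ 1); last by rewrite lerDl.
    apply: avg_op_le => op; apply: avg_set_le => // f; by case: (_ \in _).
  rewrite add0r ler_wpM2r ?invr_ge0 //; apply: ler_sum => op _.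
  rewrite ler_wpM2r ?invr_ge0 // big_mkcondr /=.
  apply: (@le_trans _ _ (\sum_(f in cand E xs Q op) (f == e)%:R)).
    apply: ler_sum => f _; rewrite mem_rcons inE (negPf eQ) orbF eq_sym.
    by case: (f \notin Q).
  have [ec|ec] := boolP (e \in cand _ _ _ _).
    rewrite (bigD1 e) //= eqxx big1 ?addr0 // => f /andP[_ /negPf ->] //.
  by rewrite big1 // => f fc; case: eqP => // fe; rewrite -fe fc in ec.
rewrite exploredD explored_mulr explored_sum.
(* One [b] covers the case that [e] is explored already; the new step costs [2 * b] for each end of
   [e]. *)
have -> : 5 ^+ r.+1 * a = b + 4 * b by rewrite exprS /b; ring.
apply: lerD; first exact: IH.
apply: avg_op_le => -[i|]; last first.
  apply: explored_le => [|xs Q]; first by rewrite mulr_ge0.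
  apply: (@le_trans _ _ a); last by rewrite (le_trans ab) // ler_peMl // ler1n.
  have -> : cand E xs Q (None : option 'I_L) = E by apply/setP => f; rewrite !inE andbT.
  by rewrite eE mul1r.
apply: (le_trans (le_explored (fun xs Q _ _ => avg_cand_le xs Q i eE))).
rewrite explored_sum big_cons big_seq1.
suff H u : touches u e ->
    explored r (fun xs Q => (onth (xs ++ ends Q) i == Some u)%:R / #|star u|%:R) <= 2 * b.
  have -> : 4 * b = 2 * b + 2 * b by ring.
  by apply: lerD; apply: H; rewrite /touches eqxx ?orbT.
move=> ue; rewrite explored_mulr.
have s0 : 0 < #|star u|%:R :> R.
  by rewrite ltr0n card_gt0; apply/set0Pn; exists e; rewrite inE eE.
rewrite ler_pdivrMr //.
apply: (le_trans (le_explored (fun xs Q Qok _ => slot_touched xs i u Qok))).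
rewrite exploredD explored_sum.
(* The first term is for [u] as a start vertex, the second is the induction hypothesis for each edge
   at [u]. As the star contains [e], the first is absorbed by doubling the second. *)
apply: (@le_trans _ _ (b + b * #|star u|%:R)).
  apply: lerD.
    apply: (le_trans _ ab); apply: (le_trans _ na); rewrite -[in leRHS](card_ord n).
    apply: (le_trans _ (avg_seq_onth R k i u)).
    by apply: le_avg_seq => xs _; apply: explore_le.
  apply: (le_trans (ler_sum _ (fun f _ => IH f))).
  by rewrite sumr_const mulr_natr.
have s1 : 1 <= #|star u|%:R :> R by rewrite ler1n -(ltr0n R).
nra.
Qed.

Definition ordered_cert xs Q (s : seq (edge n)) : R := (cert xs Q && subseq Q s)%:R.

Definition success r s : R := explored r (fun xs Q => ordered_cert xs Q s).

Lemma avg_order_explored r (g : seq 'I_n -> seq (edge n) -> seq (edge n) -> R) :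
  avg_order E (fun s => explored r (fun xs Q => g xs Q s)) =
  explored r (fun xs Q => avg_order E (g xs Q)).
Proof. by rewrite /avg_order -explored_sum explored_mulr. Qed.

Lemma avg_order_cert xs Q : view_ok E Q ->
  avg_order E (ordered_cert xs Q) = (cert xs Q)%:R / ((size Q)`!)%:R.
Proof.
move=> /andP[uQ /allP QE]; rewrite -(avg_order_subseq R uQ QE) /ordered_cert.
case: (cert xs Q); first by rewrite mul1r.
by rewrite mul0r avg_order_const.
Qed.

(** The exploration does not depend on the order, and at most [r] given edges arrive in a given
    order with probability at least [1 / r!]. *)
Lemma mean_lower_bound r :
  explored r (fun xs Q => (cert xs Q)%:R) / (r`!)%:R <=
  avg_order E (success r).
Proof.
rewrite avg_order_explored -explored_mulr; apply: le_explored => xs Q Qok Qr.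
rewrite avg_order_cert // ler_wpM2l // lef_pV2 ?posrE ?ltr0n ?fact_gt0 //.
by rewrite ler_nat leq_fact.
Qed.

(** Disjoint views have independent relative orders; if the views share an edge, the sum is at least
    1 and pays for the left side. *)
Lemma avg_order_cert2 xs Q ys P : view_ok E Q -> view_ok E P ->
  avg_order E (fun s => ordered_cert xs Q s * ordered_cert ys P s) <=
  avg_order E (ordered_cert xs Q) * avg_order E (ordered_cert ys P)
  + \sum_(e in E) (e \in Q)%:R * (e \in P)%:R.
Proof.
move=> Qok Pok; have [/andP[uQ /allP QE] /andP[uP /allP PE]] := (Qok, Pok).
have sum0 : 0 <= \sum_(e in E) (e \in Q)%:R * (e \in P)%:R :> R.
  by apply: sumr_ge0 => e _; apply: mulr_ge0.
have [/hasP[e eP eQ]|dis] := boolP (has [in Q] P).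
  apply: (@le_trans _ _ 1).
    rewrite -[leRHS](avg_order_const E (1 : R)); apply: le_avg_order => s _.
    by rewrite /ordered_cert; do 2![case: (_ && _)]; rewrite ?mulr0 ?mul0r ?mul1r.
  have eE : e \in E by apply: QE.
  have eQ' : e \in Q by [].
  rewrite (bigD1 e) //= eP eQ' mulr1 addrCA lerDl addr_ge0 //.
    by rewrite !avg_order_cert // mulr_ge0 // divr_ge0.
  by apply: sumr_ge0 => f _; apply: mulr_ge0.
have uQP : uniq (Q ++ P) by rewrite cat_uniq uQ dis.
have QPE : {subset Q ++ P <= E} by move=> e; rewrite mem_cat => /orP[/QE|/PE].
apply: (@le_trans _ _ (avg_order E (ordered_cert xs Q) * avg_order E (ordered_cert ys P))); last by rewrite lerDl.
rewrite !avg_order_cert // mulrACA -(avg_order_pair R uQP QPE) /ordered_cert.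
rewrite le_eqVlt; apply/orP; left; apply/eqP.
case: (cert xs Q); case: (cert ys P); rewrite ?mulr0 ?mul0r ?mul1r.
- by congr (_ / _); apply: eq_bigr => s _ /=; case: (subseq Q s); rewrite ?mul1r ?mul0r.
- by rewrite -[RHS](avg_order_const E (0 : R)); congr (_ / _); apply: eq_bigr => s _; rewrite mulr0.
- by rewrite -[RHS](avg_order_const E (0 : R)); congr (_ / _); apply: eq_bigr => s _; rewrite mul0r.
- by rewrite -[RHS](avg_order_const E (0 : R)); congr (_ / _); apply: eq_bigr => s _; rewrite mul0r.
Qed.

Lemma sum_explored_mem r : \sum_(e in E) explored r (fun _ Q => (e \in Q)%:R) <= r%:R.
Proof.
rewrite -explored_sum; apply: (@le_trans _ _ (explored r (fun _ _ => r%:R))).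
  apply: le_explored => _ Q /andP[uQ /allP QE] Qr.
  apply: (@le_trans _ _ (size Q)%:R); last by rewrite ler_nat.
  rewrite -(card_uniqP uQ) -sum1_card natr_sum big_mkcond [leRHS]big_mkcond /=.
  by apply: ler_sum => e _; case: (e \in E); case: (e \in Q).
exact: explored_le.
Qed.

(* Two explorations are independent of each other unless they share an edge. *)
Lemma variance_bound r (a : R) :
  n%:R^-1 <= a -> #|E|%:R^-1 <= a ->
  avg_order E (fun s => (success r s - avg_order E (success r)) ^+ 2)
  <= r%:R * (5 ^+ r * a).
Proof.
move=> na Ea; set F := success r; set mu := avg_order E F.
have FF : avg_order E (fun s => F s * F s) <= mu * mu + r%:R * (5 ^+ r * a).
  (* The square of an expectation is an expectation over two independent explorations. *)
  have -> : avg_order E (fun s => F s * F s) =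
      explored r (fun xs Q => explored r (fun ys P =>
        avg_order E (fun s => ordered_cert xs Q s * ordered_cert ys P s))).
    rewrite -(@eq_explored r (fun xs Q => avg_order E (fun s =>
      explored r (fun ys P => ordered_cert xs Q s * ordered_cert ys P s)))); last first.
      by move=> xs Q; apply: avg_order_explored.
    rewrite -avg_order_explored.
    congr (_ / _); apply: eq_bigr => s _; rewrite /F /success -explored_mulr.
    by apply: eq_explored => xs Q; rewrite explored_mull.
  apply: (@le_trans _ _ (explored r (fun xs Q => explored r (fun ys P =>
      avg_order E (ordered_cert xs Q) * avg_order E (ordered_cert ys P)
      + \sum_(e in E) (e \in Q)%:R * (e \in P)%:R)))).
    apply: le_explored => xs Q Qok _; apply: le_explored => ys P Pok _.
    exact: avg_order_cert2.
  rewrite (@eq_explored _ _ (fun xs Q => avg_order E (ordered_cert xs Q) * mu +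
      \sum_(e in E) (e \in Q)%:R * explored r (fun _ P => (e \in P)%:R))); last first.
    move=> xs Q; rewrite exploredD explored_mull explored_sum /mu avg_order_explored.
    by congr (_ + _); apply: eq_bigr => e _; rewrite explored_mull.
  rewrite exploredD explored_mulr explored_sum /mu avg_order_explored lerD2l.
  have [em ems] := (fun e => explored_mem r e na Ea, sum_explored_mem r).
  have a0 : 0 <= a by rewrite (le_trans _ na) ?invr_ge0.
  have b0 : 0 <= 5 ^+ r * a by rewrite mulr_ge0 ?exprn_ge0.
  apply: (@le_trans _ _ (\sum_(e in E) explored r (fun _ Q => (e \in Q)%:R) * (5 ^+ r * a))).
    apply: ler_sum => e _; rewrite explored_mulr ler_wpM2l ?em //.
    exact: explored_ge0.
  by rewrite -mulr_suml ler_wpM2r.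
have -> : avg_order E (fun s => (F s - mu) ^+ 2) =
    avg_order E (fun s => (- 2 * mu) * F s + (1 * (F s * F s) + mu * mu)).
  by congr (_ / _); apply: eq_bigr => s _; ring.
rewrite !avg_order_lin avg_order_const -/mu; lra.
Qed.

End Variance.

(** * Random relabellings *)

Section Relabelling.
Variable n : nat.
Implicit Types (s : {perm 'I_n}) (E H : {set edge n}) (e : edge n).

Definition redge s e : edge n := mkedge (s e.1) (s e.2).

Lemma mkedgeC (u v : 'I_n) : mkedge u v = mkedge v u.
Proof.
rewrite /mkedge; case: ltngtP => // uv; congr (_, _); apply: val_inj => //.
Qed.

Lemma mkedge_lt (u v : 'I_n) : u != v -> ((mkedge u v).1 < (mkedge u v).2)%N.
Proof.
by rewrite -(inj_eq val_inj) /mkedge neq_ltn; case: ltngtP.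
Qed.

Lemma mkedge_id e : (e.1 < e.2)%N -> mkedge e.1 e.2 = e.
Proof. by move=> lt; rewrite /mkedge lt -surjective_pairing. Qed.

Lemma redge_mkedge s (u v : 'I_n) : redge s (mkedge u v) = mkedge (s u) (s v).
Proof. by rewrite /redge {2 3}/mkedge; case: ifP => //= _; rewrite mkedgeC. Qed.

Lemma redge_lt s e : (e.1 < e.2)%N -> ((redge s e).1 < (redge s e).2)%N.
Proof.
move=> lt; apply: mkedge_lt; rewrite (inj_eq perm_inj).
by apply: contraTneq lt => ->; rewrite ltnn.
Qed.

Lemma redgeK s e : (e.1 < e.2)%N -> redge s^-1 (redge s e) = e.
Proof. by move=> lt; rewrite {2}/redge redge_mkedge !permK mkedge_id. Qed.

Lemma redgeKV s e : (e.1 < e.2)%N -> redge s (redge s^-1 e) = e.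
Proof. by move=> lt; rewrite {2}/redge redge_mkedge !permKV mkedge_id. Qed.

Lemma redge_inj s E : simple_graph E -> {in E &, injective (redge s)}.
Proof. by move=> sE e f /sE eE /sE fE ef; rewrite -(redgeK s eE) ef redgeK. Qed.

Lemma simple_relabel s E : simple_graph E -> simple_graph (relabel s E).
Proof. by move=> sE _ /imsetP[e /sE eE ->]; apply: redge_lt. Qed.

Lemma card_relabel s E : simple_graph E -> #|relabel s E| = #|E|.
Proof. by move=> sE; rewrite card_in_imset //; apply: redge_inj. Qed.

Lemma mem_relabel s E e : simple_graph E -> (e.1 < e.2)%N ->
  (e \in relabel s E) = (redge s^-1 e \in E).
Proof.
move=> sE lt; apply/imsetP/idP => [[f fE ->]|eE]; first by rewrite redgeK // sE.
by exists (redge s^-1 e); rewrite // -/(redge _ _) redgeKV.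
Qed.

Lemma edge_dist_relabel s E H : simple_graph E -> simple_graph H ->
  edge_dist (relabel s E) H = edge_dist E (relabel s^-1 H).
Proof.
move=> sE sH; set X := (E :\: relabel s^-1 H) :|: (relabel s^-1 H :\: E).
have sX : simple_graph X.
  by move=> e; rewrite !inE => /orP[] /andP[_]; [apply: sE | apply: simple_relabel].
rewrite /edge_dist -/X -(card_relabel s sX); congr #|pred_of_set _|; apply/setP => e.
have [lt|nlt] := boolP (nat_of_ord e.1 < nat_of_ord e.2)%N; last first.
  have out Y : simple_graph Y -> (e \in Y) = false.
    by move=> sY; apply: contraNF nlt => /sY.
  by rewrite !inE !out //; apply: simple_relabel.
rewrite mem_relabel // !inE !mem_relabel //; last exact: redge_lt.
by rewrite invgK redgeKV.
Qed.

Lemma far_relabel (R : realType) (eps : R) Pi s E :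
  iso_invariant Pi -> simple_graph E -> far eps Pi E -> far eps Pi (relabel s E).
Proof.
move=> iso sE fE H sH PH; rewrite card_relabel // edge_dist_relabel //.
by apply: fE; [apply: simple_relabel | apply: iso].
Qed.

Lemma mem_neighbors E (u v : 'I_n) : simple_graph E ->
  (u \in neighbors E v) = (v != u) && (mkedge v u \in E).
Proof.
move=> sE; rewrite inE; have [<-|vu] := eqVneq v u.
  by rewrite orbb; apply/negP => /sE; rewrite ltnn.
have lt (x y : 'I_n) : (x, y) \in E -> (x < y)%N by move=> /sE.
rewrite /mkedge; case: (ltnP v u) => vu'.
  by apply/orP/idP => [[/lt|//]|vE]; [rewrite ltnNge ltnW | right].
by apply/orP/idP => [[//|/lt]|uE]; [rewrite ltnNge vu' | left].
Qed.

Lemma neighbors_relabel s E v : simple_graph E ->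
  neighbors (relabel s E) (s v) = s @: neighbors E v.
Proof.
move=> sE; apply/setP => z; rewrite -[z](permKV s) (mem_imset _ _ perm_inj).
rewrite !mem_neighbors //; last exact: simple_relabel.
rewrite (inj_eq perm_inj); have [//|vz] := eqVneq v _.
rewrite mem_relabel //; last by rewrite mkedge_lt // (inj_eq perm_inj).
by rewrite redge_mkedge !permK.
Qed.

(** With [mkedge_inj], this turns a uniform neighbor of [v] into a uniform edge at [v]. *)
Lemma neighbors_touches E v : simple_graph E ->
  [set e in E | touches v e] = [set mkedge v u | u in neighbors E v].
Proof.
move=> sE; apply/setP => e; rewrite !inE; apply/andP/imsetP => [[eE ve]|[u]].
  have lt := sE e eE.
  have ne : e.1 != e.2 by rewrite -(inj_eq val_inj) /= neq_ltn lt.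
  case/orP: ve => /eqP ->; [exists e.2 | exists e.1];
    rewrite ?mem_neighbors // 1?eq_sym ?ne 1?[mkedge e.2 _]mkedgeC ?mkedge_id //=.
  by rewrite eq_sym ne.
rewrite mem_neighbors // => /andP[vu uE] ->; split=> //.
by rewrite /touches /mkedge; case: ifP; rewrite eqxx ?orbT.
Qed.

Lemma mkedge_inj (v : 'I_n) : injective (mkedge v).
Proof.
move=> u w; rewrite /mkedge.
case: ltnP => vu; case: ltnP => vw /eqP; rewrite xpair_eqE => /andP[/eqP e1 /eqP e2] //.
  by rewrite e2 ltnn in vu.
by rewrite -e2 ltnn in vw.
Qed.

Lemma neighbors0_touches E v :
  (neighbors E v == set0) = [forall e in E, ~~ touches v e].
Proof.
apply/eqP/forall_inP => [N0 e eE|tE].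
  apply/negP; rewrite /touches => ve.
  suff [u] : exists u, u \in neighbors E v by rewrite N0 inE.
  case/orP: ve => /eqP ->; [exists e.2 | exists e.1];
    by rewrite inE -surjective_pairing eE ?orbT.
apply/setP => u; rewrite !inE; apply/negP => /orP[] /tE.
  by rewrite /touches /= eqxx orbT.
by rewrite /touches /= eqxx.
Qed.

End Relabelling.

(** * Random permutations conditioned on revealed values *)

Section AgreeingPermutations.
Variables (R : realType) (n : nat).
Implicit Types (K : {set 'I_n}) (s : {perm 'I_n}).

Definition agree K s0 : {set {perm 'I_n}} :=
  [set s : {perm 'I_n} | [forall v in K, s v == s0 v]].

Lemma agreeP K s0 s : reflect {in K, s =1 s0} (s \in agree K s0).
Proof. by rewrite inE; apply: (iffP forall_inP) => h v vK; apply/eqP; apply: h. Qed.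

Lemma agreeU K s0 s1 w : s1 \in agree K s0 ->
  agree (w |: K) s1 = [set s : {perm 'I_n} in agree K s0 | s w == s1 w].
Proof.
move=> /agreeP a1; apply/setP => s; rewrite [RHS]inE; apply/agreeP/andP => [a|[/agreeP a /eqP sw] v].
  split; last by rewrite a // setU11.
  by apply/agreeP => v vK; rewrite a ?a1 // setU1r.
by rewrite in_setU1 => /predU1P[->//|vK]; rewrite a // a1.
Qed.

(* Tower property: to bound an average over [agree K s0] it suffices to bound it
   after the value at one more point is revealed. *)
Lemma agree_reveal K s0 w (h : {perm 'I_n} -> R) b :
  (forall s1, s1 \in agree K s0 ->
     \sum_(s in agree (w |: K) s1) h s <= b * #|agree (w |: K) s1|%:R) ->
  \sum_(s in agree K s0) h s <= b * #|agree K s0|%:R.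
Proof.
move=> hb; rewrite mulr_natr -sumr_const.
rewrite (partition_big (fun s : {perm 'I_n} => s w) predT) //=.
rewrite [leRHS](partition_big (fun s : {perm 'I_n} => s w) predT) //=.
apply: ler_sum => z _; set C := [set s : {perm 'I_n} in agree K s0 | s w == z].
have CE (F : {perm 'I_n} -> R) :
    \sum_(s in agree K s0 | s w == z) F s = \sum_(s in C) F s.
  by apply: eq_bigl => s; rewrite [RHS]inE.
rewrite !CE; have [->|[s1]] := set_0Vmem C; first by rewrite !big_set0.
rewrite inE => /andP[s1A /eqP s1w].
have -> : C = agree (w |: K) s1 by rewrite (agreeU w s1A) s1w.
by rewrite sumr_const -mulr_natr; apply: hb.
Qed.

(** Composing with a transposition shows that all points outside [K] are equally likely to be the
    preimage of [v], and at least half of all points are outside [K]. *)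
Lemma card_agree_preim K s0 u v : u \notin K -> (2 * #|K| <= n)%N ->
  (n * #|[set s : {perm 'I_n} in agree K s0 | s u == v]| <= 2 * #|agree K s0|)%N.
Proof.
move=> uK Kn; set C := fun w => [set s : {perm 'I_n} in agree K s0 | s w == v].
have CC w : w \notin K -> (#|C u| <= #|C w|)%N.
  move=> wK; rewrite -(card_imset _ (@mulgI _ (tperm u w))).
  apply: subset_leq_card; apply/subsetP => _ /imsetP[s + ->].
  rewrite inE => /andP[/agreeP sA sv]; rewrite inE permM tpermR sv andbT.
  apply/agreeP => x xK; rewrite permM tpermD ?sA //.
    by apply: contraNneq uK => ->.
  by apply: contraNneq wK => ->.
have sumC : (\sum_(w in ~: K) #|C w| <= #|agree K s0|)%N.
  rewrite -sum1_card (partition_big (fun s : {perm 'I_n} => s^-1%g v) predT) //=.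
  rewrite [leqRHS](bigID (mem (~: K))) /= -[leqLHS]addn0 leq_add //.
  apply: eq_leq; apply: eq_bigr => w _; rewrite -sum1_card; apply: eq_bigl => s.
  by rewrite inE; congr (_ && _); rewrite (canF_eq (permK s)) eq_sym.
have : (#|~: K| * #|C u| <= #|agree K s0|)%N.
  apply: leq_trans sumC; rewrite -sum_nat_const; apply: leq_sum => w.
  by rewrite inE; apply: CC.
have := cardsC K; rewrite card_ord -/(C u); nia.
Qed.

(** The preimage of a vertex not yet seen is uniform up to a factor 2, so it can be traded for a
    fresh uniform vertex [u]. *)
Lemma agree_locate K s0 v (h : {perm 'I_n} -> R) (b : 'I_n -> R) :
  (2 * #|K| <= n)%N -> (0 < n)%N -> s0^-1%g v \notin K -> (forall u, 0 <= b u) ->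
  (forall u s1, u \notin K -> s1 \in agree K s0 -> s1 u = v ->
     \sum_(s in agree (u |: K) s1) h s <= b u * #|agree (u |: K) s1|%:R) ->
  \sum_(s in agree K s0) h s <= 2 * ((\sum_u b u) / n%:R) * #|agree K s0|%:R.
Proof.
move=> Kn n0 vK b0 hb.
rewrite (partition_big (fun s : {perm 'I_n} => s^-1%g v) predT) //=.
have -> : 2 * ((\sum_u b u) / n%:R) * #|agree K s0|%:R =
    \sum_u b u * (2 * (n%:R^-1 * #|agree K s0|%:R)) by rewrite -mulr_suml; ring.
apply: ler_sum => u _.
rewrite (eq_bigl (mem [set s : {perm 'I_n} in agree K s0 | s u == v])); last first.
  by move=> s; rewrite [RHS]inE; congr (_ && _); rewrite (canF_eq (permK s)) eq_sym.
set C := [set s : {perm 'I_n} in agree K s0 | s u == v].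
have r0 : 0 <= b u * (2 * (n%:R^-1 * #|agree K s0|%:R)) :> R by rewrite !mulr_ge0 // invr_ge0.
have [C0|[s1]] := set_0Vmem C; first by rewrite C0 big_set0.
rewrite inE => /andP[s1A /eqP s1u].
have uK : u \notin K.
  by apply: contra vK => uK; rewrite -s1u (agreeP _ _ _ s1A) // permK.
have CE : C = agree (u |: K) s1 by rewrite (agreeU u s1A) s1u.
have bC := hb u s1 uK s1A s1u.
rewrite CE (le_trans bC) // -CE ler_wpM2l ?b0 //.
have := card_agree_preim s0 v uK Kn; rewrite -/C -(ler_nat R) !natrM => cC.
by rewrite mulrCA ler_pdivlMl ?ltr0n.
Qed.
End AgreeingPermutations.

(** * Domination of the query tester by canonical explorations *)

Section TreeBound.
Variables (R : realType) (c : R) (Pi : graph_property) (n k : nat).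
Hypothesis iso : iso_invariant Pi.
Variable E : {set edge n}.
Hypotheses (sE : simple_graph E) (E0 : E != set0) (n0 : (0 < n)%N) (kn : (6 * k <= n)%N).
Implicit Types (ys zs : seq 'I_n) (P Q : seq (edge n)) (s : {perm 'I_n}).

Definition certificate (I : seq 'I_n) P : bool :=
  `[< ~ exists H : {set edge n}, [/\ simple_graph H, Pi H, c * n%:R <= #|H|%:R,
        {subset P <= H} & {in I, forall v, neighbors H v = set0}] >].

(** Only sampled vertices isolated in [E] are evidence; the stream recognizes them at its end as the
    untouched ones. *)
Definition vcert ys P : bool :=
  certificate [seq v <- ys | neighbors E v == set0] P.

Lemma certificateW (I I' : seq 'I_n) P P' :
  {subset I <= I'} -> {subset P <= P'} -> certificate I P -> certificate I' P'.
Proof.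
move=> II PP /asboolP nex; apply/asboolP => -[H [sH PH cH PH' IH]]; apply: nex.
exists H; split=> // [e /PP /PH' //|v /II]; exact: IH.
Qed.

Lemma vcert_ext xs P Q : vcert xs P -> vcert xs (P ++ Q).
Proof. by apply: certificateW => // e eP; rewrite mem_cat eP. Qed.

(** Enough slots for [k] start vertices and both ends of [k] edges. *)
Local Notation L := (3 * k)%N.

(* Value of the exploration continued from [P] when the last [b] start vertices
   are still random. *)
Definition value b r ys P : R :=
  avg_seq b (fun zs =>
    explore L vcert E r (ys ++ zs) (fun Q => (vcert (ys ++ zs) Q)%:R) P).

Lemma value_ge0 b r ys P : 0 <= value b r ys P.
Proof. by apply: avg_seq_ge0 => zs; apply: explore_ge0. Qed.

Lemma value_reveal b r ys P :
  value b.+1 r ys P = (\sum_u value b r (rcons ys u) P) / n%:R.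
Proof.
rewrite /value /= card_ord; congr (_ / _); apply: eq_bigr => u _.
by apply: eq_avg_seq => zs _; rewrite cat_rcons.
Qed.

(** Learning a known edge again consumes no exploration step. *)
Definition value_add b r ys P e : R :=
  if e \in P then value b r.+1 ys P else value b r ys (rcons P e).

(** New edges cost a factor [L + 1], since the exploration picks [op] with probability
    [1 / (L + 1)]. Known edges leave the value as it is, which adds one more to the factor. *)
Lemma value_query b r ys P (op : option 'I_L) (S : {set edge n}) :
  (forall zs, size zs = b -> cand E (ys ++ zs) P op = S) ->
  (\sum_(e in S) value_add b r ys P e) / #|S|%:R <= (L.+2)%:R * value b r.+1 ys P.
Proof.
move=> candS; rewrite (bigID (mem P)) /= mulrDl -natr1 mulrDl mul1r addrC.
apply: lerD.
  have -> : (\sum_(e in S | e \notin P) value_add b r ys P e) / #|S|%:R =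
      avg_seq b (fun zs => (\sum_(e in S | e \notin P)
        explore L vcert E r (ys ++ zs) (fun Q => (vcert (ys ++ zs) Q)%:R) (rcons P e))
          / #|S|%:R).
    rewrite avg_seq_mulr avg_seq_sum; congr (_ / _); apply: eq_bigr => e /andP[_ eP].
    by rewrite /value_add (negPf eP).
  rewrite /value -avg_seq_mull; apply: le_avg_seq => zs zb; rewrite exploreS /extend.
  case: ifP => cP.
    rewrite explore_cert // mulr1; apply: (@le_trans _ _ 1); last by rewrite ler1n.
    apply: avg_set_le => // e; apply: explore_le => // Q; by case: (vcert _ _).
  rewrite mulrCA divff ?pnatr_eq0 // mulr1 (bigD1 op) //= (candS zs zb) lerDl.
  apply: sumr_ge0 => o _; apply: divr_ge0 => //; apply: sumr_ge0 => e _.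
  exact: explore_ge0.
have [->|S0] := eqVneq S set0; first by rewrite cards0 invr0 mulr0 value_ge0.
rewrite ler_pdivrMr ?ltr0n ?card_gt0 //.
rewrite (eq_bigr (fun=> value b r.+1 ys P)) => [|e /andP[_ eP]]; last first.
  by rewrite /value_add eP.
rewrite sumr_const -[_ *+ _]mulr_natr ler_wpM2l ?value_ge0 // ler_nat.
by apply: subset_leq_card; apply/subsetP => e /andP[].
Qed.

Definition known ys P : {set 'I_n} := [set v in ys ++ ends P].

Lemma mem_ends P v : (v \in ends P) = has (touches v) P.
Proof.
elim: P => [//|e P IH] /=; by rewrite !inE IH /touches orbA.
Qed.

Lemma card_known ys P : (#|known ys P| <= size ys + 2 * size P)%N.
Proof.
have -> : (size ys + 2 * size P = size (ys ++ ends P))%N.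
  rewrite size_cat; congr (_ + _)%N; elim: P => [//|e P IH] /=.
  by rewrite mulnS IH.
by rewrite cardsE card_size.
Qed.

Lemma known_rcons ys P u : known (rcons ys u) P = u |: known ys P.
Proof. by apply/setP => v; rewrite !inE !mem_cat mem_rcons inE orbA. Qed.

Definition addv P e := if e \in P then P else rcons P e.

Lemma mem_addv P e f : (f \in addv P e) = (f == e) || (f \in P).
Proof.
rewrite /addv; case: ifP => eP; last by rewrite mem_rcons inE.
by case: eqP => // ->.
Qed.

Lemma known_addv ys P e : known ys (addv P e) = e.1 |: (e.2 |: known ys P).
Proof.
apply/setP => v; rewrite !inE !mem_cat !mem_ends.
have -> : has (touches v) (addv P e) = touches v e || has (touches v) P.
  apply/hasP/orP => [[f]|[ve|/hasP[f fP vf]]].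
  - by rewrite mem_addv => /predU1P[->|fP vf]; [left | right; apply/hasP; exists f].
  - by exists e; rewrite // mem_addv eqxx.
  - by exists f; rewrite // mem_addv fP orbT.
by rewrite /touches; case: (v == e.1); case: (v == e.2); rewrite ?orbT.
Qed.

(* [t] still accepts all graphs of the property that agree with what the run on
   the relabelled graph has revealed. *)
Definition sound (t : qtree n) s ys P : Prop :=
  forall H : {set edge n}, simple_graph H -> Pi H -> c * n%:R <= #|H|%:R ->
    {in P, forall e, redge s e \in H} ->
    {in ys, forall v, neighbors E v = set0 -> neighbors H (s v) = set0} ->
    qaccept H t = 1 :> R.

Lemma sound_agree t s0 s1 ys P :
  s1 \in agree (known ys P) s0 -> sound t s0 ys P -> sound t s1 ys P.
Proof.
move=> /agreeP s1A snd H sH PH cH PsH IH; apply: snd => // [e eP|v vys v0].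
  have e1 : e.1 \in known ys P.
    rewrite inE mem_cat mem_ends; apply/orP; right; apply/hasP; exists e => //.
    by rewrite /touches eqxx.
  have e2 : e.2 \in known ys P.
    rewrite inE mem_cat mem_ends; apply/orP; right; apply/hasP; exists e => //.
    by rewrite /touches eqxx orbT.
  by rewrite /redge -(s1A _ e1) -(s1A _ e2); apply: PsH.
rewrite -s1A ?IH //.
by rewrite inE mem_cat vys.
Qed.

Definition reject (t : qtree n) s : R := 1 - qaccept (relabel s E) t.

Lemma sum_setT (T : finType) (F : T -> R) : \sum_(x in [set: T]) F x = \sum_x F x.
Proof. by apply: eq_bigl => x; rewrite inE. Qed.

Lemma qaccept_bounds (H : {set edge n}) t : 0 <= (qaccept H t : R) <= 1.
Proof.
have avg (T : finType) (A : {set T}) (F : T -> R) m : (#|A| <= m)%N ->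
    (forall x, 0 <= F x <= 1) -> 0 <= (\sum_(x in A) F x) / m%:R <= 1.
  move=> Am F01; apply/andP; split.
    by apply: divr_ge0 => //; apply: sumr_ge0 => x _; case/andP: (F01 x).
  have [->|m0] := posnP m; first by rewrite invr0 mulr0.
  rewrite ler_pdivrMr ?ltr0n // mul1r (@le_trans _ _ #|A|%:R) ?ler_nat //.
  rewrite -sum1_card natr_sum; apply: ler_sum => x _; by case/andP: (F01 x).
elim: t => [b|m f IH|f IH|f IH|v f IH] /=.
- by case: b; rewrite ?lexx ?ler01.
- by have := avg _ [set: 'I_m.+1] (fun i => qaccept H (f i)) m.+1; rewrite cardsT card_ord sum_setT; apply.
- by have := avg _ [set: 'I_n] (fun i => qaccept H (f i)) n; rewrite cardsT card_ord sum_setT; apply.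
- by case: ifP => // _; apply: avg.
- by case: ifP => // _; apply: avg.
Qed.

(** Passes acceptance with probability 1 from a query node to each possible answer. *)
Lemma avg_eq1 (T : finType) (A : {set T}) (F : T -> R) :
  A != set0 -> (forall x, F x <= 1) -> (\sum_(x in A) F x) / #|A|%:R = 1 ->
  {in A, forall x, F x = 1}.
Proof.
move=> A0 F1 avg1 x xA; apply/eqP; rewrite eq_le F1 /= leNgt; apply/negP => Fx.
have cA : 0 < #|A|%:R :> R by rewrite ltr0n card_gt0.
have : \sum_(x in A) F x < #|A|%:R.
  rewrite -sum1_card natr_sum (bigD1 x) //= [ltRHS](bigD1 x) //=.
  by apply: ltr_leD => //; apply: ler_sum => y _; apply: F1.
by rewrite -[ltRHS]mul1r -ltr_pdivrMr // avg1 ltxx.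
Qed.

Lemma avgT_eq1 (T : finType) (F : T -> R) m : #|T| = m ->
  (forall x, F x <= 1) -> (\sum_x F x) / m%:R = 1 -> forall x, F x = 1.
Proof.
move=> <- F1 avg1 x; apply: (@avg_eq1 _ setT); rewrite ?inE //.
  by apply/set0Pn; exists x; rewrite inE.
by rewrite cardsT sum_setT.
Qed.

Lemma avg_1B (T : finType) (A : {set T}) (F : T -> R) : A != set0 ->
  1 - (\sum_(x in A) F x) / #|A|%:R = (\sum_(x in A) (1 - F x)) / #|A|%:R.
Proof.
move=> A0; have cA : #|A|%:R != 0 :> R by rewrite pnatr_eq0 -lt0n card_gt0.
by rewrite sumrB sumr_const mulrBl divff.
Qed.

(** The loss per query: [L + 2] from [value_query], and 2 from [agree_locate]. *)
Definition factor : R := 2 * L.+2%:R.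

Lemma factor_ge1 : 1 <= factor.
Proof. by rewrite /factor -natrM ler1n. Qed.

Lemma factor_exp_ge0 m : 0 <= factor ^+ m.
Proof. by rewrite exprn_ge0 // (le_trans ler01 factor_ge1). Qed.

(** The domination, conditionally on what is revealed. A query spends at most one random start
    vertex and one exploration step, whence [m <= b] and [m <= r]. *)
Definition bounded m (t : qtree n) : Prop :=
  forall b r ys P s0, (m <= b)%N -> (m <= r)%N -> (size ys + b <= k)%N ->
    (size P + r <= k)%N -> view_ok E P -> sound t s0 ys P ->
    \sum_(s in agree (known ys P) s0) reject t s <=
    factor ^+ m * value b r ys P * #|agree (known ys P) s0|%:R.

(** A sound leaf that rejects holds a certificate: otherwise some graph of the property contains [P]
    and isolates the same vertices, and its relabelling by [s0] would have to be accepted. *)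
Lemma bounded_leaf m a : bounded m (QLeaf n a).
Proof.
move=> b r ys P s0 _ _ _ _ _ snd; case: a snd => snd.
  rewrite big1 => [|s _]; last by rewrite /reject /= subrr.
  by rewrite !mulr_ge0 ?value_ge0 ?factor_exp_ge0.
have cP zs : vcert (ys ++ zs) P.
  apply/asboolP => -[H [sH PH cH PsH IH]].
  have /eqP : qaccept (relabel s0 H) (QLeaf n false) = 1 :> R.
    apply: snd; rewrite ?card_relabel //; [exact: simple_relabel | exact: iso | |].
      by move=> e eP; apply: imset_f; apply: PsH.
    move=> v vys vE; rewrite neighbors_relabel // IH ?imset0 //.
    by rewrite mem_filter vE eqxx mem_cat vys.
  by rewrite /= eq_sym oner_eq0.
have -> : value b r ys P = 1.
  rewrite -(@avg_seq_const R 'I_n b 1) ?card_ord //; apply: eq_avg_seq => zs _.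
  by rewrite explore_cert.
rewrite mulr1 (eq_bigr (fun=> 1)) => [|s _]; last by rewrite /reject /= subr0.
by rewrite sumr_const ler_peMl // exprn_ege1 // factor_ge1.
Qed.

Lemma bounded_rand m j (f : 'I_j.+1 -> qtree n) :
  (forall i, bounded m (f i)) -> bounded m (QRand f).
Proof.
move=> fb b r ys P s0 mb mr yb Pr Pok snd.
have T0 : [set: 'I_j.+1] != set0 by apply/set0Pn; exists ord0; rewrite inE.
have rej s : reject (QRand f) s = (\sum_(i in [set: 'I_j.+1]) reject (f i) s) / #|[set: 'I_j.+1]|%:R.
  by rewrite -avg_1B // cardsT card_ord sum_setT.
rewrite (eq_bigr _ (fun s _ => rej s)) -mulr_suml exchange_big /=.
set B := factor ^+ m * _ * _.
rewrite ler_pdivrMr ?ltr0n ?card_gt0 // [leRHS]mulr_natr -sumr_const.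
apply: ler_sum => i _.
apply: fb => // H sH PH cH PsH IH.
apply: (avgT_eq1 (card_ord _) _ (snd H sH PH cH PsH IH)) => x.
by case/andP: (qaccept_bounds H (f x)).
Qed.

Lemma bounded_vert m (f : 'I_n -> qtree n) :
  (forall v, bounded m (f v)) -> bounded m.+1 (QVert f).
Proof.
move=> fb [//|b] [//|r] ys P s0 mb mr yb Pr Pok snd.
have T0 : [set: 'I_n] != set0 by apply/set0Pn; exists (Ordinal n0); rewrite inE.
have rej s : reject (QVert f) s = (\sum_u reject (f (s u)) s) / n%:R.
  have := @avg_1B _ _ (fun u => qaccept (relabel s E) (f u)) T0.
  rewrite cardsT card_ord !sum_setT /reject /= => ->; congr (_ / _).
  (* The sampled vertex is written as [s u] with [u] uniform; this [u] becomes the next start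
     vertex. *)
  by rewrite (reindex_inj (@perm_inj _ s)).
rewrite (eq_bigr _ (fun s _ => rej s)) -mulr_suml exchange_big /= value_reveal.
rewrite mulrA mulrAC ler_wpM2r ?invr_ge0 // mulr_sumr mulr_suml; apply: ler_sum => u _.
apply: (@agree_reveal _ _ _ _ u) => s1 s1A; rewrite -known_rcons.
rewrite (eq_bigr (reject (f (s1 u)))); last first.
  by move=> s /agreeP sA; rewrite sA // known_rcons setU11.
apply: (le_trans (fb (s1 u) b r.+1 (rcons ys u) P s1 _ _ _ _ _ _)) => //.
- by rewrite ltnW.
- by rewrite size_rcons addSnnS.
- move=> H sH PH cH PsH IH.
  have : qaccept H (QVert f) = 1 :> R.
    apply: (sound_agree s1A snd) => // v vys; apply: IH.
    by rewrite mem_rcons inE vys orbT.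
  move=> a1; apply: (avgT_eq1 (card_ord _) _ a1) => x.
  by case/andP: (qaccept_bounds H (f x)).
rewrite ler_wpM2r // ler_wpM2r ?value_ge0 // exprS ler_peMl ?factor_exp_ge0 //.
exact: factor_ge1.
Qed.

Lemma bounded_add m t b r ys P e s0 : bounded m t -> e \in E ->
  (m <= b)%N -> (m <= r)%N -> (size ys + b <= k)%N -> (size P + r < k)%N ->
  view_ok E P -> sound t s0 ys (addv P e) ->
  \sum_(s in agree (known ys (addv P e)) s0) reject t s <=
  factor ^+ m * value_add b r ys P e * #|agree (known ys (addv P e)) s0|%:R.
Proof.
move=> tb eE mb mr yb Pr Pok; rewrite /value_add /addv; case: ifP => eP snd.
  by apply: tb; rewrite // ?(leq_trans mr) // addnS.
apply: tb; rewrite // ?size_rcons ?addSn //.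
by rewrite view_ok_rcons eE eP.
Qed.

(** A random edge of the relabelled graph is the image of a random edge of [E]. Its two ends are
    revealed in turn, and the op [None] simulates the query. *)
Lemma bounded_edge m (f : option (edge n) -> qtree n) :
  (forall o, bounded m (f o)) -> bounded m.+1 (QEdge f).
Proof.
move=> fb b [//|r] ys P s0 mb mr yb Pr Pok snd.
have rej s : reject (QEdge f) s =
    (\sum_(e in E) reject (f (Some (redge s e))) s) / #|E|%:R.
  have E0' : relabel s E == set0 = false.
    by apply/negbTE; rewrite -card_gt0 card_relabel // card_gt0.
  rewrite {1}/reject /= E0' card_relabel //.
  by rewrite -avg_1B // big_imset //=; apply: redge_inj.
rewrite (eq_bigr _ (fun s _ => rej s)) -mulr_suml exchange_big /=.
set A := #|agree _ _|%:R.
have step e : e \in E ->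
    \sum_(s in agree (known ys P) s0) reject (f (Some (redge s e))) s <=
    factor ^+ m * value_add b r ys P e * A.
  move=> eE; apply: (@agree_reveal _ _ _ _ e.2) => s1 s1A.
  apply: (@agree_reveal _ _ _ _ e.1) => s2 s2A; rewrite -known_addv.
  have s2A' : s2 \in agree (known ys P) s0.
    by move: s2A; rewrite (agreeU _ s1A) inE => /andP[].
  rewrite (eq_bigr (reject (f (Some (redge s2 e))))); last first.
    move=> s /agreeP sA; rewrite /redge !sA // known_addv ?setU11 //.
    by rewrite setU1r // setU11.
  apply: bounded_add; rewrite // ?(ltnW mb) // -?addnS //.
  move=> H sH PH cH PsH IH.
  (* As [H] contains the new edge, the query on [H] may return it too, so the branch below has to
     accept [H] with probability 1. *)
  have eH : redge s2 e \in H by apply: PsH; rewrite mem_addv eqxx.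
  have : qaccept H (QEdge f) = 1 :> R.
    by apply: (sound_agree s2A' snd) => // g gP; apply: PsH; rewrite mem_addv gP orbT.
  have H0 : H != set0 by apply/set0Pn; exists (redge s2 e).
  rewrite /= (negPf H0) => a1.
  apply: (@avg_eq1 _ H (fun e => qaccept H (f (Some e))) H0 _ a1) => // x.
  by case/andP: (qaccept_bounds H (f (Some x))).
have cE : 0 < #|E|%:R :> R by rewrite ltr0n card_gt0.
apply: (@le_trans _ _ ((\sum_(e in E) factor ^+ m * value_add b r ys P e * A) / #|E|%:R)).
  by rewrite ler_wpM2r ?invr_ge0 //; apply: ler_sum => e; apply: step.
rewrite -mulr_suml -mulr_sumr.
have cand0 zs : size zs = b -> cand E (ys ++ zs) P (None : option 'I_L) = E.
  by move=> _; apply/setP => e; rewrite !inE andbT.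
have := value_query r cand0; set V := value _ _ _ _; set S := \sum_(e in E) _ => SV.
have -> : factor ^+ m * S * A / #|E|%:R = factor ^+ m * (S / #|E|%:R) * A by ring.
rewrite ler_wpM2r // exprSr -mulrA ler_wpM2l ?factor_exp_ge0 //.
apply: (le_trans SV); rewrite ler_wpM2r ?value_ge0 //.
by rewrite /factor ler_peMl // ler1n.
Qed.

(** A random neighbor of a known vertex is the other end of a random edge at it, which the op of its
    slot draws. *)
Lemma bounded_nbr_known m (f : option 'I_n -> qtree n) b r ys P s0 u :
  (forall o, bounded m (f o)) -> u \in known ys P ->
  (m <= b)%N -> (m <= r)%N -> (size ys + b <= k)%N -> (size P + r < k)%N ->
  view_ok E P -> sound (QNbr (s0 u) f) s0 ys P ->
  \sum_(s in agree (known ys P) s0) reject (QNbr (s0 u) f) s <=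
  factor ^+ m * (L.+2%:R * value b r.+1 ys P) * #|agree (known ys P) s0|%:R.
Proof.
move=> fb uK mb mr yb Pr Pok snd.
have nbr s : s \in agree (known ys P) s0 ->
    neighbors (relabel s E) (s0 u) = s @: neighbors E u.
  by move=> /agreeP sA; rewrite -(sA u uK) neighbors_relabel.
have [N0|N0] := eqVneq (neighbors E u) set0.
  rewrite (eq_bigr (reject (f None))); last first.
    by move=> s sA; rewrite /reject /= nbr // N0 imset0 eqxx.
  (* An isolated vertex ends no explored edge, so it is a start vertex, and soundness already
     demands that it be isolated in [H]. *)
  have uys : u \in ys.
    move: uK; rewrite inE mem_cat mem_ends => /orP[//|/hasP[e eP ue]].
    have eE : e \in E by case/andP: Pok => _ /allP; apply.
    move/eqP: N0; rewrite neighbors0_touches => /forall_inP /(_ e eE).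
    by rewrite ue.
  have V0 := value_ge0 b r.+1 ys P.
  apply: (le_trans (fb None b r.+1 ys P s0 mb _ yb _ Pok _)).
  - exact: leqW.
  - by rewrite addnS.
  - move=> H sH PH cH PsH IH; rewrite -(snd H sH PH cH PsH IH) /=.
    by rewrite IH // eqxx.
  rewrite ler_wpM2r // ler_wpM2l ?factor_exp_ge0 // ler_peMl // ler1n //.
have rej s : s \in agree (known ys P) s0 -> reject (QNbr (s0 u) f) s =
    (\sum_(w in neighbors E u) reject (f (Some (s w))) s) / #|neighbors E u|%:R.
  move=> sA; rewrite {1}/reject /= nbr // imset_eq0 (negPf N0).
  rewrite card_imset; last exact: perm_inj.
  rewrite big_imset /=; last by move=> ? ? _ _; apply: perm_inj.
  by rewrite -avg_1B.
rewrite (eq_bigr _ rej) -mulr_suml exchange_big /=.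
set A := #|agree _ _|%:R.
have step w : w \in neighbors E u ->
    \sum_(s in agree (known ys P) s0) reject (f (Some (s w))) s <=
    factor ^+ m * value_add b r ys P (mkedge u w) * A.
  rewrite mem_neighbors // => /andP[uw eE]; set e := mkedge u w in eE *.
  have eK : known ys (addv P e) = w |: known ys P.
    rewrite known_addv /e /mkedge; case: ifP => _ /=; apply/setP => v.
      rewrite !in_setU1 !inE orbA [(v == u) || _]orbC -orbA; congr (_ || _).
      by case: eqP => // ->; move: uK; rewrite inE.
    rewrite !in_setU1 !inE; congr (_ || _).
    by case: eqP => // ->; move: uK; rewrite inE.
  apply: (@agree_reveal _ _ _ _ w) => s1 s1A; rewrite -eK.
  rewrite (eq_bigr (reject (f (Some (s1 w))))); last first.
    by move=> s /agreeP sA; rewrite sA // eK setU11.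
  apply: bounded_add => // H sH PH cH PsH IH.
  have eH : mkedge (s0 u) (s1 w) \in H.
    rewrite -(agreeP _ _ _ s1A _ uK) -redge_mkedge; apply: PsH.
    by rewrite mem_addv eqxx.
  have wH : s1 w \in neighbors H (s0 u).
    rewrite mem_neighbors // eH andbT -(agreeP _ _ _ s1A _ uK).
    by rewrite (inj_eq perm_inj).
  have : qaccept H (QNbr (s0 u) f) = 1 :> R.
    by apply: (sound_agree s1A snd) => // g gP; apply: PsH; rewrite mem_addv gP orbT.
  have H0 : neighbors H (s0 u) != set0 by apply/set0Pn; exists (s1 w).
  rewrite /= (negPf H0) => a1.
  apply: (@avg_eq1 _ _ (fun e => qaccept H (f (Some e))) H0 _ a1) => // x.
  by case/andP: (qaccept_bounds H (f (Some x))).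
set S := [set e in E | touches u e].
have SE : S = [set mkedge u w | w in neighbors E u] by apply: neighbors_touches.
have cS : #|S| = #|neighbors E u| by rewrite SE card_imset //; apply: mkedge_inj.
have cE : 0 < #|S|%:R :> R by rewrite cS ltr0n card_gt0.
apply: (@le_trans _ _ ((\sum_(e in S) factor ^+ m * value_add b r ys P e * A) / #|S|%:R)).
  rewrite cS ler_wpM2r ?invr_ge0 // SE big_imset /=.
    by apply: ler_sum => w; apply: step.
  by move=> ? ? _ _; apply: mkedge_inj.
rewrite -mulr_suml -mulr_sumr.
(* The slot of [u] must not depend on [zs]: ends of explored edges are shifted by [size ys + b],
   past the start vertices that are still random. *)
have [i iu] : exists i : 'I_L, forall zs, size zs = b ->
    onth ((ys ++ zs) ++ ends P) i = Some u.
  have sP : (size (ends P) = 2 * size P)%N.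
    by elim: (P) => [//|e P' IH] /=; rewrite mulnS IH.
  move: uK; rewrite inE mem_cat => /orP[] /onthP[i iu].
    have ilt : (i < size ys)%N by rewrite -onthTE iu.
    have iL : (i < L)%N by lia.
    by exists (Ordinal iL) => zs _; rewrite -catA onth_cat ilt.
  have ilt : (i < 2 * size P)%N by rewrite -sP -onthTE iu.
  have iL : (size ys + b + i < L)%N by lia.
  exists (Ordinal iL) => zs zb; rewrite onth_cat size_cat zb /=.
  by rewrite ltnNge leq_addr /= addKn.
have candS zs : size zs = b -> cand E (ys ++ zs) P (Some i) = S.
  by move=> zb; apply/setP => e; rewrite !inE /= iu.
have := value_query r candS; set V := value _ _ _ _; set T := \sum_(e in S) _ => SV.
have -> : factor ^+ m * T * A / #|S|%:R = factor ^+ m * (T / #|S|%:R) * A by ring.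
by rewrite ler_wpM2r // ler_wpM2l ?factor_exp_ge0.
Qed.

(** If the preimage of [v] is unknown, it becomes the next start vertex at the cost of a factor 2,
    and the known case applies. *)
Lemma bounded_nbr m v (f : option 'I_n -> qtree n) :
  (forall o, bounded m (f o)) -> bounded m.+1 (QNbr v f).
Proof.
move=> fb [//|b] [//|r] ys P s0 mb mr yb Pr Pok snd.
have [uK|uK] := boolP (s0^-1%g v \in known ys P).
  rewrite -{1}[v](permKV s0).
  apply: (le_trans (@bounded_nbr_known m f b.+1 r ys P s0 _ fb uK _ _ yb _ Pok _)); rewrite ?permKV //.
  - exact: ltnW.
  - by rewrite -addnS.
  rewrite ler_wpM2r // exprSr -!mulrA ler_wpM2l ?factor_exp_ge0 //.
  by rewrite mulrA ler_wpM2r ?value_ge0 // /factor ler_peMl // ler1n.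
pose beta u := factor ^+ m * (L.+2%:R * value b r.+1 (rcons ys u) P).
apply: (le_trans (@agree_locate _ _ _ s0 v _ beta _ n0 uK _ _)).
(* At most [3 * k] vertices are known, which is at most half of all by [6 * k <= n]. *)
- by have := card_known ys P; lia.
- by move=> u; rewrite /beta !mulr_ge0 ?value_ge0 ?factor_exp_ge0.
- move=> u s1 _ s1A s1u; rewrite -known_rcons -s1u.
  apply: (@bounded_nbr_known m f b r) => //.
  + by rewrite known_rcons setU11.
  + by rewrite size_rcons addSnnS.
  + by rewrite -addnS.
  + rewrite s1u => H sH PH cH PsH IH; apply: (sound_agree s1A snd) => // x xys.
    by apply: IH; rewrite mem_rcons inE xys orbT.
rewrite ler_wpM2r // value_reveal /beta -mulr_sumr -mulr_sumr.
set F := factor ^+ m.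
by rewrite exprSr -/F /factor le_eqVlt; apply/orP; left; apply/eqP; ring.
Qed.

Lemma boundedP m (t : qtree n) : (qcount t <= m)%N -> bounded m t.
Proof.
elim: t m => [a|j f IH|f IH|f IH|v f IH] m /=.
- by move=> _; apply: bounded_leaf.
- move=> fm; apply: bounded_rand => i; apply: IH; rewrite (leq_trans _ fm) //.
  exact: (@leq_bigmax _ (fun x => qcount (f x))).
- case: m => // m; rewrite ltnS => fm; apply: bounded_vert => v; apply: IH; rewrite (leq_trans _ fm) //.
  exact: (@leq_bigmax _ (fun x => qcount (f x))).
- case: m => // m; rewrite ltnS => fm; apply: bounded_edge => o; apply: IH; rewrite (leq_trans _ fm) //.
  exact: (@leq_bigmax _ (fun x => qcount (f x))).
- case: m => // m; rewrite ltnS => fm; apply: bounded_nbr => o; apply: IH; rewrite (leq_trans _ fm) //.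
  exact: (@leq_bigmax _ (fun x => qcount (f x))).
Qed.

(** The domination at the root, where nothing is revealed and the average runs over all
    relabellings. *)
Lemma tester_le_value (t : qtree n) (a : R) : (qcount t <= k)%N ->
  (forall H : {set edge n}, simple_graph H -> Pi H -> c * n%:R <= #|H|%:R ->
     qaccept H t = 1 :> R) ->
  (forall s, a <= reject t s) ->
  a <= factor ^+ k * value k k [::] [::].
Proof.
move=> tk acc rej.
have snd : sound t 1%g [::] [::] by move=> H sH PH cH _ _; apply: acc.
have := @boundedP k t tk k k [::] [::] 1%g (leqnn _) (leqnn _) (leqnn _) (leqnn _) isT snd.
set A := agree _ _.
have A0 : 0 < #|A|%:R :> R.
  by rewrite ltr0n; apply/card_gt0P; exists 1%g; apply/agreeP.
move=> h; rewrite -(ler_pM2r A0); apply: le_trans h.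
by rewrite mulr_natr -sumr_const; apply: ler_sum => s _; apply: rej.
Qed.

End TreeBound.

(** * Amplification *)

Section ViewSupport.
Variables (R : realType) (n L B : nat) (E : {set edge n}).

Fixpoint rall A (t : rtree A) (p : A -> Prop) : Prop :=
  match t with
  | RRet a => p a
  | RRand k f => forall i, rall (f i) p
  end.

Lemma rall_bind A A' (t : rtree A) (f : A -> rtree A') (p : A' -> Prop) :
  rall t (fun a => rall (f a) p) -> rall (rbind t f) p.
Proof. by elim: t => [//|k h IH] /= H i; apply: IH. Qed.

Lemma rallW A (t : rtree A) (p p' : A -> Prop) :
  (forall a, p a -> p' a) -> rall t p -> rall t p'.
Proof. by move=> pp; elim: t => [a|k f IH] /=; [exact: pp | move=> H i; apply: IH]. Qed.

Lemma rexp_rall0 A (t : rtree A) (g : A -> R) :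
  rall t (fun a => g a = 0) -> rexp t g = 0.
Proof.
elim: t => [//|k f IH] /= H; rewrite big1 ?mul0r // => i _; exact: IH.
Qed.

Definition view_in r (P : seq (edge n)) (st : level n L B r) : Prop :=
  {subset level_view P st <= E}.

Lemma level_init_in r P : {subset P <= E} ->
  rall (level_init n L B r) (view_in (r := r) P).
Proof. by move=> PE; case: r => [//|r] /=. Qed.

Lemma subset_rcons (P : seq (edge n)) e :
  {subset P <= E} -> e \in E -> {subset rcons P e <= E}.
Proof. by move=> PE eE f; rewrite mem_rcons => /predU1P[->|/PE]. Qed.

Lemma level_step_in r xs P e (st : level n L B r) :
  e \in E -> {subset P <= E} -> view_in P st ->
  rall (level_step xs P e st) (view_in (r := r) P).
Proof.
elim: r P st => [//|r IH] P [op [[[f c] st1]|]] eE PE /= viewE.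
  have fE : {subset rcons P f <= E}.
    by have [Q vQ] := level_view_ext (rcons P f) st1;
      move=> g gP; apply: viewE; rewrite /= vQ mem_cat gP.
  have stored (c' : 'I_B.+1) : rall (rbind (level_step xs (rcons P f) e st1)
      (fun st2 => RRet (op, Some (f, c', st2)))) (view_in (r := r.+1) P).
    by apply: rall_bind; apply: (rallW _ (IH (rcons P f) st1 eE fE viewE)).
  case: ifP => _ //= i; case: ifP => _ //.
  apply: rall_bind; apply: (rallW _ (level_init_in _ (subset_rcons PE eE))) => st0 //.
case: ifP => _ //=.
by apply: rall_bind; apply: (rallW _ (level_init_in _ (subset_rcons PE eE))) => st0.
Qed.

(** Follows the support of the run instead of probabilities: every reachable view consists of edges
    of [E]. This yields acceptance with probability exactly 1. *)
Lemma level_exp0 r xs P g s :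
  {subset P <= E} -> {subset s <= E} -> (forall Q, {subset Q <= E} -> g Q = 0) ->
  level_exp L B r xs P g s = 0 :> R.
Proof.
move=> PE sE g0; apply: rexp_rall0; apply: (rallW _ (level_init_in _ PE)) => st.
elim: s st sE => [|e s IH] st sE vE /=; first exact: g0.
apply: rexp_rall0; apply: (rallW _ (level_step_in xs (sE e (mem_head _ _)) PE vE)).
by move=> st' vE'; apply: IH => // f fs; apply: sE; rewrite inE fs orbT.
Qed.

End ViewSupport.

Section Amplification.
Variable R : realType.

(** A Bernoulli-type inequality, giving explicit decay of [(1 - x) ^+ N] without logarithms. *)
Lemma expr_1B_bound (x : R) N : 0 <= x <= 1 -> (1 - x) ^+ N * (1 + N%:R * x) <= 1.
Proof.
move=> /andP[x0 x1]; elim: N => [|N IH]; first by rewrite expr0 mul0r addr0 mulr1.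
apply: le_trans IH; rewrite exprSr -mulrA ler_wpM2l ?exprn_ge0 ?subr_ge0 //.
rewrite -natr1; have N0 : 0 <= N%:R :> R by []. nra.
Qed.

Lemma expr_1B_small (d : R) : 0 < d <= 1 -> exists N, (1 - d / 2) ^+ N <= 1 / 6.
Proof.
(* With [N * d > 10], the factor [1 + N * d / 2] exceeds 6. *)
move=> /andP[d0 d1]; exists (Num.bound (10 / d)); set N := Num.bound _.
have N10 : 10 / d < N%:R by apply: archi_boundP; rewrite divr_ge0 // ltW.
have xb : 0 <= d / 2 <= 1 by apply/andP; split; lra.
have := expr_1B_bound N xb; set y := (1 - d / 2) ^+ N => yb.
have y0 : 0 <= y by rewrite /y exprn_ge0 //; lra.
have Nd : 10 < N%:R * d by rewrite -ltr_pdivrMr.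
nra.
Qed.

(* Chebyshev: either [f] is at least half of [d], or it deviates from [mu]. *)
Lemma expr_1B_chebyshev (d mu f : R) N : 0 < d -> d <= mu -> 0 <= f <= 1 -> d <= 1 ->
  (1 - f) ^+ N <= (1 - d / 2) ^+ N + 4 / d ^+ 2 * (f - mu) ^+ 2.
Proof.
move=> d0 dmu /andP[f0 f1] d1.
have q0 : 0 <= 4 / d ^+ 2 * (f - mu) ^+ 2 by rewrite mulr_ge0 ?divr_ge0 ?sqr_ge0.
have [df|fd] := leP (d / 2) f.
  by rewrite -[leLHS]addr0 lerD // lerXn2r ?nnegrE ?subr_ge0 //; lra.
apply: (@le_trans _ _ 1); first by rewrite exprn_ile1 ?subr_ge0 //; lra.
rewrite -[leLHS]add0r lerD //; first by rewrite exprn_ge0 //; lra.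
rewrite mulrAC ler_pdivlMr ?exprn_gt0 // mul1r.
(* From [f < d / 2] and [d <= mu] the deviation exceeds [d / 2]; the product is the difference of
   the squares. *)
have : 0 <= (mu - f - d / 2) * (mu - f + d / 2) by apply: mulr_ge0; lra.
by rewrite !expr2; nra.
Qed.

End Amplification.

(** * Correctness of the streaming tester and choice of constants *)

Section Final.
Variables (R : realType) (c : R) (Pi : graph_property).
Hypotheses (c0 : 0 < c) (iso : iso_invariant Pi).

Definition tester_for n k (v0 : 'I_n) : state_alg n (tester_state n k (3 * k) (n * n)) :=
  tester k (3 * k) (n * n) v0 (@certificate R c Pi n).

Section Run.
Variables (n k : nat) (v0 : 'I_n) (E : {set edge n}) (s : seq (edge n)).
Hypotheses (sE : simple_graph E) (sperm : perm_eq s (enum E)).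

Let sorder : uniq s * {subset s <= E} * (size s <= n * n)%N.
Proof.
have us : uniq s by rewrite (perm_uniq sperm) enum_uniq.
split; first split=> //; first by move=> e; rewrite (perm_mem sperm) mem_enum.
by rewrite -(card_uniqP us) (leq_trans (max_card _)) // card_prod card_ord.
Qed.

Lemma untouched_isolated xs :
  untouched s xs = [seq v <- xs | neighbors E v == set0].
Proof.
apply: eq_filter => v; rewrite neighbors0_touches.
rewrite (perm_all _ sperm); apply/allP/forall_inP => h e.
  by move=> eE; apply: h; rewrite mem_enum.
by rewrite mem_enum; apply: h.
Qed.

(** The graph [E] itself refutes every would-be certificate made of its edges and isolated
    vertices. *)
Lemma tester_accepts : Pi E -> c * n%:R <= #|E|%:R -> aaccept R (tester_for k v0) s = 1.
Proof.
move=> PE cE; rewrite aaccept_tester.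
rewrite -[RHS](@avg_seq_const R 'I_n k 1); last by apply/card_gt0P; exists v0.
apply: eq_avg_seq => xs _; rewrite (@level_exp0 _ _ _ _ E) ?subr0 //.
  by case: sorder => -[].
move=> Q QE; rewrite untouched_isolated.
case: (boolP (certificate _ _ _ _)) => // /asboolP[]; exists E; split=> //.
by move=> v; rewrite mem_filter => /andP[/eqP].
Qed.

Lemma tester_rejects :
  aaccept R (tester_for k v0) s <= 1 - success R (3 * k) k (vcert c Pi E) E k s.
Proof.
have T0 : (0 < #|'I_n|)%N by apply/card_gt0P; exists v0.
rewrite aaccept_tester -[X in _ <= X - _](@avg_seq_const R 'I_n k 1 T0) -mulN1r -avg_seq_mull -avg_seqD.
apply: le_avg_seq => xs _; rewrite mulN1r lerD2l lerN2 untouched_isolated.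
case: sorder => -[us sE' sB].
apply: le_trans (@explore_le_level_exp R n _ _ E (vcert c Pi E) _ k xs [::] s us sE' sB).
- apply: le_explore_ext => Q; rewrite /ordered_cert drop0 //.
- by move=> ys P Q; apply: vcert_ext.
Qed.

End Run.

(** Here [d] bounds the mean success from below: rejection probability 2/3, the loss of [k] queries,
    and [1 / k!] for the arrival order. One error of 1/6 is that all [N] runs fail on a typical
    order, the other is that the order is atypical. *)
Lemma far_testable_large (eps : R) k n (t : qtree n) N q (d : R) :
  (6 * k * N <= q)%N ->
  d = 2 / 3 / factor R k ^+ k / (k`!)%:R ->
  (1 - d / 2) ^+ N <= 1 / 6 ->
  4 / d ^+ 2 * (k%:R * (5 ^+ k * ((1 + c^-1) / n%:R))) <= 1 / 6 ->
  (0 < n)%N -> (6 * k <= n)%N -> (qcount t <= k)%N ->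
  (forall E : {set edge n}, simple_graph E -> c * n%:R <= #|E|%:R ->
     (Pi E -> qaccept E t = 1 :> R) /\ (far eps Pi E -> qaccept E t <= 1 / 3 :> R)) ->
  exists A : stream_alg n q,
    forall E : {set edge n}, simple_graph E -> c * n%:R <= #|E|%:R ->
      (Pi E -> saccept A E = 1 :> R) /\ (far eps Pi E -> saccept A E <= 1 / 3 :> R).
Proof.
move=> Nq dE dN dn n0 kn tk tP; pose v0 := Ordinal n0.
have d0 : 0 < d.
  rewrite dE !divr_gt0 ?ltr0n ?fact_gt0 // exprn_gt0 //.
  exact: lt_le_trans (factor_ge1 R k).
have small : (#|pow_state (tester_state n k (3 * k) (n * n)) N| <=
    #|{: memory n q}|)%N.
  rewrite card_pow_state card_memory (leq_trans _ (leq_pexp2l _ Nq)) // expnM.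
  have [->|N0] := posnP N; first by [].
  rewrite leq_exp2r // card_tester_state //.
  by rewrite ltnS (leq_trans _ (leq_addr _ _)) // (leq_trans _ kn) // leq_mul2r orbT.
exists (encode_alg small (pow_alg (tester_for k v0) N)) => E sE cE.
have accE : saccept (encode_alg small (pow_alg (tester_for k v0) N)) E =
    avg_order E (fun s => aaccept R (tester_for k v0) s ^+ N).
  rewrite saccept_encode; congr (_ / _).
  by apply: eq_bigr => s _; rewrite aaccept_pow.
rewrite accE; split=> [PE|farE].
  rewrite -[RHS](avg_order_const E (1 : R)); congr (_ / _); apply: eq_big_seq => s.
  by rewrite mem_permutations => sp; rewrite (tester_accepts k v0 sE sp) // expr1n.
have cn : 0 < c * n%:R by rewrite mulr_gt0 ?ltr0n.
have E0 : E != set0 by rewrite -card_gt0 -(ltr0n R) (lt_le_trans cn).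
set F := success R (3 * k) k (vcert c Pi E) E k; set mu := avg_order E F.
have dmu : d <= mu.
  apply: le_trans (mean_lower_bound R (3 * k) k (vcert c Pi E) E k).
  rewrite dE ler_wpM2r ?invr_ge0 // ler_pdivrMr; last first.
    by rewrite exprn_gt0 // (lt_le_trans _ (factor_ge1 R k)).
  rewrite [X in _ <= X]mulrC; apply: (tester_le_value iso sE E0 n0 kn tk) => [H sH PH cH|s].
    by have [acc _] := tP H sH cH; apply: acc.
  have sR := simple_relabel (s := s) sE.
  have cR : c * n%:R <= #|relabel s E|%:R by rewrite card_relabel.
  have [_ /(_ (far_relabel s iso sE farE))] := tP _ sR cR.
  by rewrite /reject; lra.
have F01 s : 0 <= F s <= 1.
  rewrite /F /success; apply/andP; split.
    by apply: explored_ge0 => xs Q; rewrite /ordered_cert.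
  by apply: explored_le => // xs Q; rewrite /ordered_cert; case: (_ && _).
have d1 : d <= 1.
  apply: (le_trans dmu); rewrite -(avg_order_const E (1 : R)); apply: le_avg_order => s _.
  by case/andP: (F01 s).
apply: (@le_trans _ _ (avg_order E (fun s =>
    4 / d ^+ 2 * (F s - mu) ^+ 2 + (1 - d / 2) ^+ N))).
  apply: le_avg_order => s sp; rewrite addrC.
  apply: (le_trans _ (expr_1B_chebyshev N d0 dmu (F01 s) d1)).
  apply: lerXn2r; rewrite ?nnegrE ?aaccept_ge0 ?subr_ge0 //.
    by case/andP: (F01 s).
  exact: tester_rejects.
rewrite avg_order_lin avg_order_const.
(* A common bound for the probabilities of a given vertex and of a given edge, the latter by
   [#|E| >= c * n]. *)
have a1 : n%:R^-1 <= (1 + c^-1) / n%:R.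
  by rewrite -[leLHS]mul1r ler_wpM2r ?invr_ge0 // lerDl invr_ge0 ltW.
have a2 : #|E|%:R^-1 <= (1 + c^-1) / n%:R.
  apply: (@le_trans _ _ (c * n%:R)^-1).
    by rewrite lef_pV2 ?posrE // (lt_le_trans cn).
  by rewrite invfM ler_wpM2r ?invr_ge0 // lerDr.
have := variance_bound (3 * k) k (vcert c Pi E) n0 k a1 a2; rewrite -/F -/mu => var.
have q0 : 0 <= 4 / d ^+ 2 by rewrite divr_ge0 ?sqr_ge0.
have := ler_wpM2l q0 var; lra.
Qed.

End Final.

Theorem theorem6p3 (R : realType) (c : R) (Pi : graph_property) :
  0 < c -> iso_invariant Pi ->
  query_testable c Pi -> stream_testable c Pi.
Proof.
move=> c0 iso QT eps eps0; have [k kP] := QT eps eps0.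
pose d : R := 2 / 3 / factor R k ^+ k / (k`!)%:R.
have fk : 1 <= factor R k ^+ k by rewrite exprn_ege1 // factor_ge1.
have fk0 : 0 < factor R k ^+ k := lt_le_trans ltr01 fk.
have d0 : 0 < d by rewrite !divr_gt0 ?ltr0n ?fact_gt0.
have d1 : d <= 1.
  rewrite ler_pdivrMr ?ltr0n ?fact_gt0 // mul1r.
  apply: (@le_trans _ _ 1); last by rewrite ler1n fact_gt0.
  by rewrite ler_pdivrMr // mul1r; apply: le_trans fk; lra.
have [|N dN] := @expr_1B_small R d; first by rewrite d0 d1.
(* Chosen so that the Chebyshev term equals [K / n / 6], hence is at most 1/6 once [n > K]. *)
pose K := 6 * (4 / d ^+ 2 * (k%:R * (5 ^+ k * (1 + c^-1)))).
have K0 : 0 <= K.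
  have ci : 0 <= c^-1 by rewrite invr_ge0 ltW.
  by rewrite !mulr_ge0 ?invr_ge0 ?sqr_ge0 ?exprn_ge0 ?addr_ge0.
pose n0 := (6 * k + Num.bound K).+1.
(* Words for [N] parallel testers when [n >= n0], and for storing the whole graph when [n < n0]. *)
pose q := maxn (6 * k * N) (n0 * n0).
exists q => n; have [t [tk tP]] := kP n.
have [nn0|n0n] := ltnP n n0.
  have small : (2 ^ (n * n) <= (n + n * n).+1 ^ q)%N.
    have [->|n1] := posnP n; first by rewrite expn_gt0.
    apply: (@leq_trans (2 ^ q)).
      by rewrite leq_exp2l // leq_max (leq_mul (ltnW nn0) (ltnW nn0)) orbT.
    have [->|q0] := posnP q; first by [].
    by rewrite leq_exp2r // ltnS addn_gt0 n1.
  have [A AP] := store_testable R (Pi n) small.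
  exists A => E sE cE; rewrite AP; have [acc rej] := tP E sE cE.
  split=> [/asboolT -> //|farE]; case: asboolP => [PE|_]; last by rewrite divr_ge0.
  (* A far graph cannot have the property, as the query tester would accept it with probability both
     1 and at most 1/3. *)
  by move: (acc PE) (rej farE) => ->; lra.
have n1 : (0 < n)%N by apply: leq_trans n0n.
have kn : (6 * k <= n)%N by apply: leq_trans n0n; rewrite ltnW // ltnS leq_addr.
have Kn : K < n%:R.
  apply: (lt_le_trans (archi_boundP K0)); rewrite ler_nat (leq_trans _ n0n) //.
  by rewrite ltnW // ltnS leq_addl.
have dn : 4 / d ^+ 2 * (k%:R * (5 ^+ k * ((1 + c^-1) / n%:R))) <= 1 / 6.
  have n0R : 0 < n%:R :> R by rewrite ltr0n.
  have -> : 4 / d ^+ 2 * (k%:R * (5 ^+ k * ((1 + c^-1) / n%:R))) = K / n%:R / 6.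
    by rewrite /K; field; rewrite ?gt_eqF.
  by rewrite ler_pM2r ?invr_gt0 // ler_pdivrMr // mul1r ltW.
exact: (far_testable_large c0 iso (leq_maxl _ _) (erefl d) dN dn n1 kn tk tP).
Qed.
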